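(* Let $m\in\mathbb N$. For every Dirichlet series $\sum_n a_n n^{-s}\in\mathcal H^m_\infty$, the non-increasing rearrangement $(a_n^* )$ of $(|a_n|)$ belongs to $\ell_{\frac{2m}{m+1},1}$ (equivalently, $(a_n)\in\ell_{\frac{2m}{m+1},1}$).
   Context: A Dirichlet series $\sum_n a_n n^{-s}$ is $m$-homogeneous if $a_n\ne0$ implies $n=\mathfrak p^\alpha=\prod_k p_k^{\alpha_k}$ with $|\alpha|=\sum_k\alpha_k=m$ ($p_k$ the $k$-th prime). $\mathcal H^m_\infty$ is the space of $m$-homogeneous Dirichlet series converging on $\{\mathrm{Re}\,s>0\}$ whose sum is a bounded function there. For $1<p<\infty$, $\ell_{p,1}$ is the space of sequences $x$ with $\sum_k x_k^*(k^{1/p}-(k-1)^{1/p})<\infty$, $x^*$ the non-increasing rearrangement of $(|x_k|)$. *)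

(* Defs.v *)
From Stdlib Require Import Reals ZArith Znumtheory List.
From Coquelicot Require Import Coquelicot.
Open Scope R_scope.

(* n^{-s} for a positive integer n and complex s:
   n^{-s} = exp(-s ln n) = n^{-Re s} (cos (Im s ln n) - i sin (Im s ln n)). *)
Definition npow_neg (n : nat) (s : C) : C :=
  Cmult (RtoC (Rpower (INR n) (- Re s)))
        (cos (Im s * ln (INR n)), - sin (Im s * ln (INR n))).

Definition has_degree (n m : nat) : Prop :=
  exists l : list nat, length l = m /\
    List.Forall (fun p => Znumtheory.prime (Z.of_nat p)) l /\ fold_right Nat.mul 1%nat l = n.

(* a : nat -> C, a n is the coefficient of n^{-s} (n >= 1; a 0 is ignored). *)
Definition m_homogeneous (m : nat) (a : nat -> C) : Prop :=
  forall n : nat, (0 < n)%nat -> a n <> RtoC 0 -> has_degree n m.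

Definition dirichlet_sum (a : nat -> C) (s : C) (l : C) : Prop :=
  is_series (fun k : nat => Cmult (a (S k)) (npow_neg (S k) s)) l.

Definition in_Hm_infty (m : nat) (a : nat -> C) : Prop :=
  m_homogeneous m a /\
  (forall s : C, 0 < Re s -> exists l, dirichlet_sum a s l) /\
  (exists M : R, forall (s l : C), 0 < Re s -> dirichlet_sum a s l -> Cmod l <= M).

Definition rearrangement (x : nat -> R) (k : nat) : Rbar :=
  Rbar_glb (fun y : Rbar => exists F : list nat, (length F < k)%nat /\
     y = Rbar_lub (fun z : Rbar => exists n : nat, (0 < n)%nat /\ ~ In n F /\
                                   z = Finite (Rabs (x n)))).

(* Weight k^{1/p} - (k-1)^{1/p} for k >= 1 (with 0^{1/p} = 0). *)
Definition lorentz_weight (p : R) (k : nat) : R :=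
  Rpower (INR k) (/ p) - (match k with 1%nat => 0 | _ => Rpower (INR (k - 1)) (/ p) end).

Definition in_lorentz_p1 (p : R) (x : nat -> R) : Prop :=
  exists y : nat -> R,
    (forall k : nat, (1 <= k)%nat -> rearrangement x k = Finite (y k)) /\
    ex_series (fun j : nat => y (S j) * lorentz_weight p (S j)).

(* Main.v *)
Require Import Defs.
From Stdlib Require Import Reals Lra Lia ZArith Znumtheory FunctionalExtensionality Classical.
From Coquelicot Require Import Coquelicot.
Open Scope R_scope.

(** Averaging f(s) = sum_n a_n n^(-s) over vertical lines against a nonnegative
    Riesz product prod_p (1 + 2 sum_j z_(p,j) cos (j t ln p)), where
    2 m |z_(p,j)| <= 1, shows that sum_n a_n prod_(p | n) z_(p, v_p(n)) is bounded
    by a constant independent of the finite set of primes involved. Contour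
    shifting makes the average at small abscissa computable from the absolutely
    convergent one at abscissa 3, and unique factorization identifies the limit.
    This bounded expression is a multilinear polynomial in the independent
    variables z_(p,j), of degree at most m, with pairwise distinct monomials. A
    Markov inequality bounds the l1 norm of its gradient on the cube, and
    Khinchine's inequality for sign polynomials then gives sum_p Y_p < oo, where
    Y_p^2 = sum_(p | n) |a_n|^2.
    Finally, put U_n = min_(p | n) Y_p and let w_j be the Lorentz weights. Then
    2 |a_n| w_j <= |a_n|^2 / U_n + w_j^2 U_n; the first terms sum up to at most
    sum_p Y_p, and so do the second ones up to a factor m, because w_j^2 is at most
    j^(-(m-1)/m) and at most #{p | Y_p > t}^m of the n satisfy U_n > t. *)

(** Using one variable z_(p,j) per prime and exponent, instead of the power z_p^j, makes the
    polynomial multilinear and lets n be read off its monomial, so real signs can replace unimodular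
    variables. The price is a factor (4m)^m, because up to m exponents share one Riesz factor and
    each z_(p,j) must be of size 1/(2m) to keep it nonnegative. A nonnegative kernel of mean value 1
    averages a function bounded by M to at most M. The obstacle is conditional convergence: near the
    imaginary axis uniform convergence is available only for bounded t, so the averaging length T
    and the length N of the partial sum cannot grow independently. N is therefore chosen after T,
    and every error is O(1/T) uniformly in N; for nonresonant terms this uniformity comes from
    absolute convergence at abscissa 3. The exponent p = 2m/(m+1) enters through 2(1/p - 1) =
    -(m-1)/m: with this decay the first c^m squared weights sum to at most m c, so the |P|^m
    integers built from a set P of primes cost only m |P|, a quantity linear in P like sum_p Y_p. *)

Module LorentzBH.
From HB Require Import structures.
From mathcomp Require Import all_boot.
Set Implicit Arguments.
Unset Strict Implicit.
Unset Printing Implicit Defensive.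
Local Open Scope R_scope.

(** * Finite sums of reals *)

Lemma RplusAssoc : associative Rplus. Proof. by move=> x y z; ring. Qed.
Lemma RmultAssoc : associative Rmult. Proof. by move=> x y z; ring. Qed.
HB.instance Definition _ :=
  Monoid.isComLaw.Build R 0 Rplus RplusAssoc Rplus_comm Rplus_0_l.
HB.instance Definition _ :=
  Monoid.isComLaw.Build R 1 Rmult RmultAssoc Rmult_comm Rmult_1_l.
HB.instance Definition _ :=
  Monoid.isMulLaw.Build R 0 Rmult Rmult_0_l Rmult_0_r.
Lemma RmultDl : left_distributive Rmult Rplus. Proof. by move=> x y z; ring. Qed.
Lemma RmultDr : right_distributive Rmult Rplus. Proof. by move=> x y z; ring. Qed.
HB.instance Definition _ :=
  Monoid.isAddLaw.Build R Rmult Rplus RmultDl RmultDr.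
Notation "\sum_ ( i <- r | P ) F" := (\big[Rplus/0]_(i <- r | P%B) F) : R_scope.
Notation "\sum_ ( i <- r ) F" := (\big[Rplus/0]_(i <- r) F) : R_scope.
Notation "\sum_ ( m <= i < n ) F" := (\big[Rplus/0]_(m <= i < n) F) : R_scope.
Notation "\sum_ ( m <= i < n | P ) F" := (\big[Rplus/0]_(m <= i < n | P%B) F) : R_scope.
Notation "\prod_ ( i <- r ) F" := (\big[Rmult/1]_(i <- r) F) : R_scope.
Section RealSums.
Variables (I : eqType).
Implicit Types (r : seq I) (P : pred I) (F G : I -> R).
Lemma rsum_le r P F G : (forall i, i \in r -> P i -> F i <= G i) -> \sum_(i <- r | P i) F i <= \sum_(i <- r | P i) G i.
Proof.
move=> le; rewrite big_seq_cond [X in _ <= X]big_seq_cond.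
apply: (big_ind2 Rle); [lra|move=> *; lra|].
by move=> i /andP[ir Pi]; apply: le.
Qed.
Lemma rsum_ge0 r P F : (forall i, i \in r -> P i -> 0 <= F i) -> 0 <= \sum_(i <- r | P i) F i.
Proof.
move=> ge0; rewrite big_seq_cond; apply: (big_ind (Rle 0)); [lra|move=> *; lra|].
by move=> i /andP[ir Pi]; apply: ge0.
Qed.
Lemma Rabs_rsum r P F : Rabs (\sum_(i <- r | P i) F i) <= \sum_(i <- r | P i) Rabs (F i).
Proof.
apply: (big_ind2 (fun a b => Rabs a <= b)) => [|a b c d|i _]; [by rewrite Rabs_R0; lra| |lra].
by move=> ? ?; apply: Rle_trans (Rabs_triang _ _) _; lra.
Qed.
Lemma rsumZ r P F c : \sum_(i <- r | P i) (c * F i) = c * \sum_(i <- r | P i) F i.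
Proof. by rewrite big_distrr. Qed.
Lemma rsumB r P F G : \sum_(i <- r | P i) (F i - G i) = \sum_(i <- r | P i) F i - \sum_(i <- r | P i) G i.
Proof.
elim: r => [|x r IH]; rewrite ?big_nil ?big_cons; first by lra.
by case: ifP => _; rewrite IH; lra.
Qed.
End RealSums.

(** * Khinchine's inequality for sign polynomials *)

Section Signs.
Variable V : eqType.
Implicit Types (y : V -> R) (v w : V) (l s : seq V) (g h : (V -> R) -> R).

Definition upd y v x : V -> R := fun w => if w == v then x else y w.

(** Expectation of [g] over independent uniform signs at the points of [l], with the other
    coordinates frozen at [y]. The recursion allows inequalities to be proved one sign at a time. *)
Fixpoint sgnE l g y : R :=
  if l is v :: l' then (sgnE l' g (upd y v 1) + sgnE l' g (upd y v (-1))) / 2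
  else g y.

Lemma updC y v w a b : v != w -> upd (upd y v a) w b = upd (upd y w b) v a.
Proof.
move=> vw; apply: functional_extensionality => u; rewrite /upd.
by case: (eqVneq u w) => // ->; rewrite eq_sym (negbTE vw).
Qed.

Lemma sgnE_le l g h y :
  (forall y', (forall w, w \notin l -> y' w = y w) ->
     (forall w, w \in l -> y' w = 1 \/ y' w = -1) -> g y' <= h y') ->
  sgnE l g y <= sgnE l h y.
Proof.
elim: l y => [|v l IH] y gh /=; first by apply: gh.
have aux x : x = 1 \/ x = -1 -> sgnE l g (upd y v x) <= sgnE l h (upd y v x).
  move=> hx; apply: IH => y' off on; apply: gh => w.
    by rewrite inE => /norP[wv wl]; rewrite off // /upd (negbTE wv).
  rewrite inE; case: (boolP (w \in l)) => [wl _|wl]; first exact: on.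
  by rewrite orbF => /eqP wv; rewrite off // /upd wv eqxx.
by have := aux 1 (or_introl erefl); have := aux (-1) (or_intror erefl); lra.
Qed.

Lemma sgnE_eq l g h y :
  (forall y', (forall w, w \notin l -> y' w = y w) ->
     (forall w, w \in l -> y' w = 1 \/ y' w = -1) -> g y' = h y') ->
  sgnE l g y = sgnE l h y.
Proof.
by move=> gh; apply: Rle_antisym; apply: sgnE_le => y' a b; rewrite gh //; lra.
Qed.

Lemma sgnE_cst l a y : sgnE l (fun=> a) y = a.
Proof. by elim: l y => //= v l IH y; rewrite !IH; lra. Qed.

Lemma sgnED l g h y : sgnE l (fun y => g y + h y) y = sgnE l g y + sgnE l h y.
Proof. by elim: l y => //= v l IH y; rewrite !IH; lra. Qed.

Lemma sgnEZ l a g y : sgnE l (fun y => a * g y) y = a * sgnE l g y.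
Proof. by elim: l y => //= v l IH y; rewrite !IH; lra. Qed.

Lemma sgnE_sum (I : Type) (r : seq I) (G : I -> (V -> R) -> R) l y :
  sgnE l (fun y => \sum_(i <- r) G i y) y = \sum_(i <- r) sgnE l (G i) y.
Proof.
elim: r => [|i r IH].
  rewrite big_nil -[RHS](sgnE_cst l 0 y).
  by apply: sgnE_eq => y' _ _; rewrite big_nil.
rewrite big_cons -IH -sgnED.
by apply: sgnE_eq => y' _ _; rewrite big_cons.
Qed.

Lemma sgnE_indep l g y v x : v \notin l ->
  (forall y x, g (upd y v x) = g y) -> sgnE l g (upd y v x) = sgnE l g y.
Proof.
move=> + gv; elim: l y => [|w l IH] y /=; first by rewrite gv.
by rewrite inE => /norP[vw vl]; rewrite !(updC _ _ _ vw) !IH.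
Qed.

Lemma sgnE_odd l g y v : v \notin l ->
  (forall y, g (upd y v (-1)) = - g (upd y v 1)) ->
  sgnE l g (upd y v (-1)) = - sgnE l g (upd y v 1).
Proof.
move=> + gv; elim: l y => [|w l IH] y /=; first by rewrite gv.
by rewrite inE => /norP[vw vl]; rewrite !(updC _ _ _ vw) !IH //; lra.
Qed.

(** The two values of the sign at [v] cancel each other. This is the source of orthogonality between
    distinct monomials. *)
Lemma sgnE_odd0 l g y v : uniq l -> v \in l ->
  (forall y, g (upd y v (-1)) = - g (upd y v 1)) -> sgnE l g y = 0.
Proof.
move=> + + gv; elim: l y => [|w l IH] y //= /andP[wl ul].
rewrite inE; case: (eqVneq v w) => [vw _|vw /= vl].
  by rewrite -!vw sgnE_odd //; [lra|rewrite vw].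
by rewrite !IH //; lra.
Qed.

Lemma sgnE_CS l g h y :
  (sgnE l (fun y => g y * h y) y) ^ 2 <=
  sgnE l (fun y => g y ^ 2) y * sgnE l (fun y => h y ^ 2) y.
Proof.
have ge0 k z l' : 0 <= sgnE l' (fun y => k y ^ 2) z.
  by rewrite -[X in X <= _](sgnE_cst l' 0 z); apply: sgnE_le => y' _ _; nra.
elim: l y => [|v l IH] y /=; first by apply: Req_le; ring.
have := IH (upd y v 1); have := IH (upd y v (-1)).
have := ge0 g (upd y v 1) l; have := ge0 g (upd y v (-1)) l.
have := ge0 h (upd y v 1) l; have := ge0 h (upd y v (-1)) l.
move: (sgnE _ _ _) (sgnE _ _ _) (sgnE _ _ _) (sgnE _ _ _) => f c e b.
move: (sgnE _ _ _) (sgnE _ _ _) => d a f0 c0 e0 b0 dd aa.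
(* Only the cross term needs work: a^2 d^2 <= (bc)(ef) = (bf)(ec), and the geometric mean is at most
   the arithmetic one. *)
suff : Rabs (a * d) <= (b * f + e * c) / 2.
  by have := Rle_abs (a * d); nra.
rewrite -(Rabs_pos_eq ((b * f + e * c) / 2)); last by nra.
apply: Rsqr_le_abs_0; rewrite /Rsqr.
have : a ^ 2 * d ^ 2 <= (b * c) * (e * f) by apply: Rmult_le_compat; nra.
have := pow2_ge_0 (b * f - e * c); nra.
Qed.

Definition mon s y : R := \prod_(v <- s) y v.

Lemma mon_upd_notin s y v x : v \notin s -> mon s (upd y v x) = mon s y.
Proof.
move=> vs; apply: eq_big_seq => w ws; rewrite /upd.
by case: eqP => // wv; rewrite -wv ws in vs.
Qed.

Lemma mon_rem s y v : v \in s -> mon s y = y v * mon (rem v s) y.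
Proof. by move=> vs; rewrite /mon (big_rem v vs). Qed.

Lemma mon_upd_in s y v x : uniq s -> v \in s ->
  mon s (upd y v x) = x * mon (rem v s) y.
Proof.
move=> us vs; rewrite (mon_rem _ vs) mon_upd_notin; first by rewrite /upd eqxx.
by rewrite mem_rem_uniq // inE eqxx.
Qed.

Variable I : eqType.
Implicit Types (r : seq I) (c : I -> R) (S : I -> seq V).

Definition mpoly r c S y : R := \sum_(i <- r) (c i * mon (S i) y).

Lemma mpoly_split v r c S y :
  mpoly r c S y = mpoly [seq i <- r | v \notin S i] c S y +
    y v * mpoly [seq i <- r | v \in S i] c (fun i => rem v (S i)) y.
Proof.
rewrite /mpoly -rsumZ !big_filter (bigID (fun i => v \in S i)) /= Rplus_comm.
congr (_ + _); apply: eq_bigr => i vi.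
by rewrite (mon_rem _ vi); ring.
Qed.

(* Hypercontractivity with exponents 2 and 4: writing X = X0 + y_v X1,
   E X^4 = E X0^4 + 6 E X0^2 X1^2 + E X1^4, where deg X1 < d. *)
Lemma bonami l d r c S y : uniq l ->
  (forall i, i \in r -> uniq (S i)) ->
  (forall i, i \in r -> count (mem l) (S i) <= d)%nat ->
  sgnE l (fun y => mpoly r c S y ^ 4) y <=
  9 ^ d * (sgnE l (fun y => mpoly r c S y ^ 2) y) ^ 2.
Proof.
elim: l d r S y => [|v l IH] d r S y /=.
  move=> _ _ _; have : 1 <= 9 ^ d by apply: pow_R1_Rle; lra.
  move: (mpoly _ _ _ _) => x h; have := pow2_ge_0 (x ^ 2); nra.
move=> /andP[vl ul] uS degS.
set r0 := [seq i <- r | v \notin S i]; set r1 := [seq i <- r | v \in S i].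
pose S1 i := rem v (S i).
pose X0 := mpoly r0 c S; pose X1 := mpoly r1 c S1.
have X0v z x : X0 (upd z v x) = X0 z.
  apply: eq_big_seq => i; rewrite mem_filter => /andP[vi _].
  by rewrite mon_upd_notin.
have X1v z x : X1 (upd z v x) = X1 z.
  apply: eq_big_seq => i; rewrite mem_filter => /andP[vi ir].
  by rewrite mon_upd_notin // mem_rem_uniq ?uS // inE eqxx.
have step k x : sgnE l (fun y => mpoly r c S y ^ k) (upd y v x) =
    sgnE l (fun y => (X0 y + x * X1 y) ^ k) y.
  rewrite -(@sgnE_indep l _ y v x vl); last by move=> z t; rewrite X0v X1v.
  apply: sgnE_eq => y' off _; rewrite (mpoly_split v) -/r0 -/r1.
  by rewrite (off v vl) /upd eqxx.
have -> : (sgnE l (fun y => mpoly r c S y ^ 4) (upd y v 1) +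
   sgnE l (fun y => mpoly r c S y ^ 4) (upd y v (-1))) / 2 =
   sgnE l (fun y => X0 y ^ 4) y + 6 * sgnE l (fun y => X0 y ^ 2 * X1 y ^ 2) y
   + sgnE l (fun y => X1 y ^ 4) y.
  rewrite !step -sgnED /Rdiv Rmult_comm -sgnEZ -sgnEZ -!sgnED.
  by apply: sgnE_eq => z _ _; field.
have -> : (sgnE l (fun y => mpoly r c S y ^ 2) (upd y v 1) +
   sgnE l (fun y => mpoly r c S y ^ 2) (upd y v (-1))) / 2 =
   sgnE l (fun y => X0 y ^ 2) y + sgnE l (fun y => X1 y ^ 2) y.
  rewrite !step -sgnED /Rdiv Rmult_comm -sgnEZ -!sgnED.
  by apply: sgnE_eq => z _ _; field.
have deg0 i : i \in r0 -> (count (mem l) (S i) <= d)%nat.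
  rewrite mem_filter => /andP[vi ir]; apply: leq_trans (degS i ir).
  by apply: sub_count => w /= wl; rewrite inE wl orbT.
have u0 i : i \in r0 -> uniq (S i) by rewrite mem_filter => /andP[_ /uS].
have u1 i : i \in r1 -> uniq (S1 i).
  by rewrite mem_filter => /andP[_ /uS ?]; apply: rem_uniq.
have deg1 i : i \in r1 -> (count (mem l) (S1 i) < d)%nat.
  rewrite mem_filter => /andP[vi ir]; apply: leq_trans (degS i ir).
  rewrite (permP (perm_to_rem vi)) /= inE eqxx /= add1n ltnS.
  by apply: sub_count => w /= wl; rewrite inE wl orbT.
have A0 := IH d r0 S y ul u0 deg0.
(* In degree 0 no monomial contains [v], so X1 vanishes; otherwise X1 has one degree less and gains
   a factor 9. *)
case: d degS deg0 A0 deg1 => [|d] degS deg0 A0 deg1.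
  have r1nil : r1 = [::].
    by case: (r1) deg1 => // i r' /(_ i); rewrite inE eqxx => /(_ isT).
  have X10 z : X1 z = 0 by rewrite /X1 /mpoly r1nil big_nil.
  have -> : sgnE l (fun y => X0 y ^ 2 * X1 y ^ 2) y = 0.
    by rewrite -[RHS](sgnE_cst l 0 y); apply: sgnE_eq => z _ _; rewrite X10; ring.
  have -> : sgnE l (fun y => X1 y ^ 4) y = 0.
    by rewrite -[RHS](sgnE_cst l 0 y); apply: sgnE_eq => z _ _; rewrite X10; ring.
  have -> : sgnE l (fun y => X1 y ^ 2) y = 0.
    by rewrite -[RHS](sgnE_cst l 0 y); apply: sgnE_eq => z _ _; rewrite X10; ring.
  by rewrite /X0; lra.
have B0 := IH d r1 S1 y ul u1 deg1.
have CS := sgnE_CS l (fun y => X0 y ^ 2) (fun y => X1 y ^ 2) y.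
have e4 (g : (V -> R) -> R) : sgnE l (fun y => (g y ^ 2) ^ 2) y = sgnE l (fun y => g y ^ 4) y.
  by apply: sgnE_eq => z _ _; ring.
rewrite !e4 in CS.
have ge0 (g : (V -> R) -> R) : 0 <= sgnE l (fun y => g y ^ 2) y.
  by rewrite -[X in X <= _](sgnE_cst l 0 y); apply: sgnE_le => y' _ _; nra.
have := ge0 X0; have := ge0 X1.
have a40 : 0 <= sgnE l (fun y => X0 y ^ 4) y by rewrite -e4.
have b40 : 0 <= sgnE l (fun y => X1 y ^ 4) y by rewrite -e4.
have n9 : 1 <= 9 ^ d by apply: pow_R1_Rle; lra.
move: A0 B0 CS a40 b40; rewrite -/X0 -/X1 /=.
move: (sgnE _ _ _) (sgnE _ _ _) (sgnE _ _ _) (sgnE _ _ _) (sgnE _ _ _) n9.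
move: (9 ^ d) => K C B b4 A a4 K1 A0 B0 CS a40 b40 Bge Age.
(* With K = 9^d, the fourth moments are at most 9 K A^2 and K B^2, so Cauchy-Schwarz gives C <= 3 K
   A B. Then 6 C <= 18 K A B is exactly the cross term of 9 K (A + B)^2, which is where the constant
   9 comes from. *)
have CC : C <= 3 * K * (A * B).
  have AB : 0 <= A * B by nra.
  apply: Rsqr_incr_0_var; last by apply: Rmult_le_pos; nra.
  have := Rmult_le_compat _ _ _ _ a40 b40 A0 B0.
  rewrite /Rsqr; lra.
have : 0 <= K * B * B by apply: Rmult_le_pos => //; nra.
nra.
Qed.

(** Parseval's identity: a variable in exactly one of [S i] and [S j] makes the product of the two
    monomials odd, so off-diagonal expectations vanish, while squares of signs are 1. *)
Lemma sgnE_mpoly_sq l r c S y : uniq l -> uniq r ->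
  (forall i, i \in r -> uniq (S i)) ->
  (forall i, i \in r -> {subset S i <= l}) ->
  (forall i j, i \in r -> j \in r -> i != j ->
     exists2 v, v \in l & (v \in S i) != (v \in S j)) ->
  sgnE l (fun y => mpoly r c S y ^ 2) y = \sum_(i <- r) c i ^ 2.
Proof.
move=> ul ur uS Sl dS.
have -> : sgnE l (fun y => mpoly r c S y ^ 2) y =
    \sum_(i <- r) \sum_(j <- r) (c i * c j * sgnE l (fun y => mon (S i) y * mon (S j) y) y).
  transitivity (sgnE l (fun y => \sum_(i <- r) \sum_(j <- r) (c i * c j * (mon (S i) y * mon (S j) y))) y).
    apply: sgnE_eq => z _ _; rewrite /= Rmult_1_r /mpoly big_distrl /=.
    apply: eq_bigr => i _; rewrite big_distrr /=.
    by apply: eq_bigr => j _; ring.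
  rewrite sgnE_sum; apply: eq_bigr => i _; rewrite sgnE_sum.
  by apply: eq_bigr => j _; rewrite sgnEZ.
apply: eq_big_seq => i ir; rewrite (bigD1_seq i) //= big_seq_cond big1 => [|j /andP[jr ji]].
  have -> : sgnE l (fun y => mon (S i) y * mon (S i) y) y = 1.
    rewrite -[RHS](sgnE_cst l 1 y); apply: sgnE_eq => z _ on.
    have : forall v, v \in S i -> z v = 1 \/ z v = -1 by move=> v /(Sl _ ir) /on.
    rewrite /mon; elim: (S i) => [|v s IHs] zs; first by rewrite !big_nil; lra.
    rewrite !big_cons; have := IHs (fun w ws => zs w (mem_behead (s := v :: s) ws)).
    by move: (\big[_/_]_(_ <- _) _) => t tt; case: (zs v (mem_head _ _)) => ->; lra.
  by ring.
rewrite eq_sym in ji.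
have [v vl vij] := dS _ _ ir jr ji.
rewrite (@sgnE_odd0 _ _ _ v) //; first by ring.
move=> z.
case: (boolP (v \in S i)) (boolP (v \in S j)) vij => [vi|vi] [vj|vj] // _.
  by rewrite !(mon_upd_notin _ _ vj) !(mon_upd_in _ _ _ vi) ?uS //; ring.
by rewrite !(mon_upd_notin _ _ vi) !(mon_upd_in _ _ _ vj) ?uS //; ring.
Qed.

(** The fourth moment prevents the second from living on rare large values: integrate x^2 <= mu |x|
    + x^4 / mu^2 and absorb the last term on the left. *)
Lemma khinchine l d r c S y : uniq l -> uniq r ->
  (forall i, i \in r -> uniq (S i)) ->
  (forall i, i \in r -> {subset S i <= l}) ->
  (forall i j, i \in r -> j \in r -> i != j ->
     exists2 v, v \in l & (v \in S i) != (v \in S j)) ->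
  (forall i, i \in r -> size (S i) <= d)%nat ->
  sqrt (\sum_(i <- r) c i ^ 2) <=
  2 * sqrt (2 * 9 ^ d) * sgnE l (fun y => Rabs (mpoly r c S y)) y.
Proof.
move=> ul ur uS Sl dS degS.
rewrite -(sgnE_mpoly_sq c y ul ur uS Sl dS).
have deg i : i \in r -> (count (mem l) (S i) <= d)%nat.
  by move=> ir; apply: leq_trans (degS i ir); apply: count_size.
have := bonami c y ul uS deg.
have : 0 <= sgnE l (fun y => mpoly r c S y ^ 2) y.
  by rewrite -[X in X <= _](sgnE_cst l 0 y); apply: sgnE_le => y' _ _; nra.
have : 0 <= sgnE l (fun y => Rabs (mpoly r c S y)) y.
  rewrite -[X in X <= _](sgnE_cst l 0 y); apply: sgnE_le => y' _ _; exact: Rabs_pos.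
have K1 : 1 <= 9 ^ d by apply: pow_R1_Rle; lra.
set X := mpoly r c S; set A := sgnE l (fun y => X y ^ 2) y.
set a := sgnE l _ y => a0 A0 B.
case: (Req_dec A 0) => [->|An0].
  by rewrite sqrt_0; apply: Rmult_le_pos => //; have := sqrt_pos (2 * 9 ^ d); lra.
have Apos : 0 < A by lra.
(* This threshold makes the fourth-moment term at most A / 2, by [bonami]. *)
pose mu := sqrt (2 * 9 ^ d * A).
have mupos : 0 < mu by apply: sqrt_lt_R0; nra.
have mu2 : mu ^ 2 = 2 * 9 ^ d * A by rewrite /mu pow2_sqrt; nra.
have pt x : x ^ 2 <= mu * Rabs x + x ^ 4 / mu ^ 2.
  have x4 : 0 <= x ^ 4 / mu ^ 2.
    apply: Rmult_le_pos; last by apply/Rlt_le/Rinv_0_lt_compat; nra.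
    by have := pow2_ge_0 (x ^ 2); nra.
  have ax := Rabs_pos x; have xx : x ^ 2 = Rabs x ^ 2 by rewrite pow2_abs.
  case: (Rle_dec (Rabs x) mu) => h; first by rewrite xx; nra.
  suff : x ^ 2 <= x ^ 4 / mu ^ 2 by nra.
  apply: (Rmult_le_reg_r (mu ^ 2)); first by nra.
  have -> : x ^ 4 / mu ^ 2 * mu ^ 2 = x ^ 2 * x ^ 2 by field; lra.
  by apply: Rmult_le_compat_l; [nra|rewrite xx; nra].
have key : A <= mu * a + / mu ^ 2 * (9 ^ d * A ^ 2).
  apply: (Rle_trans _ (mu * a + / mu ^ 2 * sgnE l (fun y => X y ^ 4) y)).
    rewrite -!sgnEZ -sgnED; apply: sgnE_le => z _ _.
    by have := pt (X z); rewrite /Rdiv Rmult_comm; lra.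
  apply: Rplus_le_compat_l; apply: Rmult_le_compat_l B.
  by apply/Rlt_le/Rinv_0_lt_compat; nra.
have half : / mu ^ 2 * (9 ^ d * A ^ 2) = A / 2 by rewrite mu2; field; lra.
have sA : sqrt A * sqrt A = A by apply: sqrt_sqrt; lra.
have sApos : 0 < sqrt A by apply: sqrt_lt_R0.
have muE : mu = sqrt (2 * 9 ^ d) * sqrt A by rewrite /mu sqrt_mult //; nra.
apply: (Rmult_le_reg_r (sqrt A)) => //.
rewrite sA; nra.
Qed.

End Signs.

(** * The mixed (l1, l2) norm of a bounded polynomial *)

(* The combination q(t) - 2^(m+1) q(t/2) kills the top coefficient. *)
Lemma coef_bound m : exists2 C, 0 <= C & forall (q : nat -> R) M,
  (forall t, Rabs t <= 1 -> Rabs (\sum_(0 <= k < m.+1) (q k * t ^ k)) <= M) ->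
  forall k, (k <= m)%nat -> Rabs (q k) <= C * M.
Proof.
elim: m => [|m [C C0 IH]].
  exists 1; first by lra.
  move=> q M h k; rewrite leqn0 => /eqP ->.
  by have := h 1; rewrite big_nat1 Rabs_R1 /= Rmult_1_r; lra.
pose D := C * (1 + 2 ^ m.+1).
have P1 : 1 <= 2 ^ m.+1 by apply: pow_R1_Rle; lra.
have D0 : 0 <= D by apply: Rmult_le_pos; lra.
exists (1 + INR m.+2 * D).
  by have := pos_INR m.+2; nra.
move=> q M h.
have M0 : 0 <= M.
  by have := h 0; rewrite Rabs_R0 => /(_ ltac:(lra)); have := Rabs_pos (\sum_(0 <= k < m.+2) (q k * 0 ^ k)); lra.
pose r k := q k * (1 - 2 ^ m.+1 * (/ 2) ^ k).
have half k : (/ 2) ^ k * 2 ^ k = 1.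
  by rewrite -Rpow_mult_distr Rinv_l ?pow1 //; lra.
have low k : (k <= m)%nat -> Rabs (q k) <= D * M.
  move=> km.
  have rk : Rabs (r k) <= C * ((1 + 2 ^ m.+1) * M).
    apply: IH km => t t1.
    have -> : \sum_(0 <= k < m.+1) (r k * t ^ k) =
      \sum_(0 <= k < m.+2) (q k * t ^ k) - 2 ^ m.+1 * \sum_(0 <= k < m.+2) (q k * (t / 2) ^ k).
      rewrite -rsumZ -rsumB [RHS]big_nat_recr //=.
      rewrite [X in _ = _ + X](_ : _ = 0); last first.
        transitivity (q m.+1 * t ^ m.+1 * (1 - (/ 2) ^ m.+1 * 2 ^ m.+1)).
          rewrite /Rdiv Rpow_mult_distr /=.
          by move: (2 ^ m) ((/ 2) ^ m) (t ^ m) (/ 2) => *; ring.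
        by rewrite half; ring.
      rewrite Rplus_0_r; apply: eq_bigr => j _.
      rewrite /r /Rdiv Rpow_mult_distr /=; move: ((/ 2) ^ j) (2 ^ m) => *; ring.
    apply: Rle_trans (Rabs_triang _ _) _.
    rewrite Rabs_Ropp Rabs_mult (Rabs_pos_eq (2 ^ m.+1)); last by lra.
    have t2 : Rabs (t / 2) <= 1.
      by rewrite /Rdiv Rabs_mult (Rabs_pos_eq (/ 2)); lra.
    by have := h t t1; have := h _ t2; nra.
  (* For k <= m the product is 2^(m+1-k) >= 2, so dividing by this factor costs nothing. *)
  have g1 : 1 <= Rabs (1 - 2 ^ m.+1 * (/ 2) ^ k).
    have -> : 2 ^ m.+1 = 2 ^ k * 2 * 2 ^ (m - k).
      have -> : 2 ^ k * 2 * 2 ^ (m - k) = 2 ^ (k + 1 + (m - k)) by rewrite !Rdef_pow_add pow_1.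
      by congr (_ ^ _); rewrite addn1 addSn subnKC.
    have := half k; have : 1 <= 2 ^ (m - k) by apply: pow_R1_Rle; lra.
    move: ((/2)^k) (2 ^ k) (2 ^ (m - k)) => a b e e1 ab.
    by rewrite Rabs_minus_sym Rabs_pos_eq; nra.
  move: rk; rewrite /r Rabs_mult /D; have := Rabs_pos (q k).
  move: (Rabs (1 - _)) g1 (Rabs (q k)) => u u1 z; nra.
move=> k; rewrite leq_eqVlt => /predU1P[->|]; last first.
  rewrite ltnS => /low; have := pos_INR m.+1; rewrite (S_INR m.+1).
  have : 0 <= D * M by nra.
  by nra.
have := h 1; rewrite Rabs_R1 => /(_ ltac:(lra)).
rewrite big_nat_recr // pow1 !Rmult_1_r.
have : Rabs (\sum_(0 <= i < m.+1) (q i * 1 ^ i)) <= INR m.+1 * (D * M).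
  apply: Rle_trans (Rabs_rsum _ _ _) _.
  have -> : INR m.+1 * (D * M) = \sum_(0 <= i < m.+1) (D * M).
    elim: (m.+1) => [|j IHj]; first by rewrite big_nil /=; ring.
    by rewrite big_nat_recr // S_INR -IHj /=; ring.
  apply: rsum_le => i; rewrite mem_index_iota => /andP[_ im] _.
  by rewrite pow1 Rmult_1_r; apply: low.
set s := \big[_/_]_(_ <= _ < _) _ => hs hq.
have := Rabs_triang (s + q m.+1) (- s); rewrite Rabs_Ropp.
have -> : s + q m.+1 + - s = q m.+1 by ring.
rewrite (S_INR m.+1); have : 0 <= D * M by nra.
by change (Rabs (s + q m.+1) <= M) in hq; nra.
Qed.

Section Gradient.
Variable V : eqType.
Implicit Types (s l : seq V) (y e : V -> R).

(** Coefficient of t^k in the product of the y v + t e v over [s], that is, of [mon s] restricted to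
    a line. *)
Fixpoint line_coef s y e (k : nat) : R :=
  if s is v :: s' then
    y v * line_coef s' y e k +
    e v * (if k is k'.+1 then line_coef s' y e k' else 0)
  else if k is 0%nat then 1 else 0.

Lemma line_coef_mon s y e n t : (size s <= n)%nat ->
  mon s (fun v => y v + t * e v) = \sum_(0 <= k < n.+1) (line_coef s y e k * t ^ k).
Proof.
elim: s n => [|v s IH] n /= sn.
  rewrite /mon big_nil big_ltn // big_nat_cond big1 => [|[|k]] //=; first by ring.
  by move=> _; ring.
case: n sn => // n; rewrite ltnS => sn.
rewrite /mon big_cons -/(mon s _).
transitivity (\sum_(0 <= k < n.+2) (y v * (line_coef s y e k * t ^ k)) +
    \sum_(0 <= k < n.+2) (e v * (if k is k'.+1 then line_coef s y e k' else 0) * t ^ k)).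
  rewrite rsumZ -IH ?leqW // [X in _ = _ + X]big_nat_recl //= Rmult_0_r Rmult_0_l.
  rewrite Rplus_0_l (eq_bigr (fun k => e v * t * (line_coef s y e k * t ^ k))).
    by rewrite rsumZ -IH //; ring.
  by move=> k _; ring.
by rewrite -big_split /=; apply: eq_bigr => k _; ring.
Qed.

Lemma line_coef1 s y e : uniq s ->
  line_coef s y e 1 = \sum_(v <- s) (e v * mon (rem v s) y).
Proof.
have lc0 s' : line_coef s' y e 0 = mon s' y.
  by elim: s' => [|v s' IH] /=; rewrite /mon ?big_nil // big_cons IH -/(mon _ _); ring.
elim: s => [|v s IH] /=; first by rewrite big_nil.
move=> /andP[vs us]; rewrite big_cons eqxx lc0 IH // -rsumZ Rplus_comm.
congr (_ + _); apply: eq_big_seq => w ws.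
have vw : v != w by apply: contraNneq vs => ->.
by rewrite (negbTE vw) /mon big_cons; ring.
Qed.

Variable I : eqType.
Implicit Types (r : seq I) (c : I -> R) (S : I -> seq V).

(** The partial derivative in [v] when every [S i] is duplicate-free. *)
Definition dmpoly r c S v : (V -> R) -> R :=
  mpoly [seq i <- r | v \in S i] c (fun i => rem v (S i)).

(** Let e be the sign pattern of the gradient at y. The l1 norm of the gradient is then the linear
    coefficient of the polynomial on the line y + t e, which stays in the cube of radius 2 for |t|
    <= 1. The coefficient bound is taken in degree m + 1 so that index 1 is in range even for m =
    0. *)
Lemma gradient_bound m C :
  (forall (q : nat -> R) M,
    (forall t, Rabs t <= 1 -> Rabs (\sum_(0 <= k < m.+2) (q k * t ^ k)) <= M) ->
    forall k, (k <= m.+1)%nat -> Rabs (q k) <= C * M) ->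
  forall r l c S M, uniq l ->
  (forall i, i \in r -> uniq (S i)) ->
  (forall i, i \in r -> {subset S i <= l}) ->
  (forall i, i \in r -> size (S i) <= m)%nat ->
  (forall z, (forall v, Rabs (z v) <= 2) -> Rabs (mpoly r c S z) <= M) ->
  forall y, (forall v, Rabs (y v) <= 1) ->
  \sum_(v <- l) Rabs (dmpoly r c S v y) <= C * M.
Proof.
move=> HC r l c S M ul uS Sl deg hM y y1.
pose e v := if Rle_dec 0 (dmpoly r c S v y) then 1 else -1.
have e1 v : Rabs (e v) <= 1.
  by rewrite /e; case: (Rle_dec _ _) => ? /=; rewrite ?Rabs_Ropp Rabs_R1; lra.
pose q k := \sum_(i <- r) (c i * line_coef (S i) y e k).
have q1 : q 1%nat = \sum_(v <- l) Rabs (dmpoly r c S v y).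
  transitivity (\sum_(i <- r) \sum_(v <- l | v \in S i) (c i * (e v * mon (rem v (S i)) y))).
    apply: eq_big_seq => i ir; rewrite line_coef1 ?uS // rsumZ; congr (_ * _).
    rewrite -[RHS]big_filter; apply: perm_big; apply: uniq_perm.
    - exact: uS.
    - exact: filter_uniq.
    - by move=> v; rewrite mem_filter; case: (boolP (v \in S i)) => //= /(Sl _ ir) ->.
  rewrite (exchange_big_dep predT) //=; apply: eq_bigr => v _.
  have -> : Rabs (dmpoly r c S v y) = e v * dmpoly r c S v y.
    rewrite /e; case: (Rle_dec _ _) => h /=; first by rewrite Rabs_pos_eq //; rewrite Rmult_1_l.
    by rewrite Rabs_left; [ring|exact: Rnot_le_lt].
  rewrite /dmpoly /mpoly big_filter -rsumZ.
  by apply: eq_bigr => i _; ring.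
rewrite -q1; apply: Rle_trans (Rle_abs _) _; apply: HC => // t t1.
have -> : \sum_(0 <= k < m.+2) (q k * t ^ k) = mpoly r c S (fun v => y v + t * e v).
  transitivity (\sum_(0 <= k < m.+2) \sum_(i <- r) (c i * (line_coef (S i) y e k * t ^ k))).
    by apply: eq_bigr => k _; rewrite /q big_distrl /=; apply: eq_bigr => i _; ring.
  rewrite exchange_big /=; apply: eq_big_seq => i ir.
  by rewrite rsumZ -line_coef_mon // leqW // deg.
apply: hM => v; apply: Rle_trans (Rabs_triang _ _) _; rewrite Rabs_mult.
by have := y1 v; have := e1 v; have := Rabs_pos t; have := Rabs_pos (e v); nra.
Qed.

End Gradient.

(** Khinchine turns each l2 norm into the mean absolute value of a partial derivative. Summing over
    the variables inside the expectation leaves the l1 norm of the gradient, bounded at every sign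
    vector. Sets that both contain [v] stay distinct after its removal. *)
Theorem mixed_norm_bound m : exists2 C, 0 <= C &
  forall (V I : eqType) (r : seq I) (l : seq V) (c : I -> R) (S : I -> seq V) M,
  uniq l -> uniq r ->
  (forall i, i \in r -> uniq (S i)) ->
  (forall i, i \in r -> {subset S i <= l}) ->
  (forall i, i \in r -> size (S i) <= m)%nat ->
  (forall i j, i \in r -> j \in r -> i != j ->
     exists w, (w \in S i) != (w \in S j)) ->
  (forall z, (forall v, Rabs (z v) <= 2) -> Rabs (mpoly r c S z) <= M) ->
  \sum_(v <- l) sqrt (\sum_(i <- r | v \in S i) c i ^ 2) <= C * M.
Proof.
have [C C0 HC] := coef_bound m.+1.
set K := 2 * sqrt (2 * 9 ^ m).
have K0 : 0 <= K by rewrite /K; have := sqrt_pos (2 * 9 ^ m); lra.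
exists (K * C); first exact: Rmult_le_pos.
move=> V I r l c S M ul ur uS Sl deg dS hM.
pose y0 : V -> R := fun=> 0.
pose D v := dmpoly r c S v.
apply: (Rle_trans _ (\sum_(v <- l) (K * sgnE l (fun y => Rabs (D v y)) y0))).
  apply: rsum_le => v vl _; rewrite -big_filter; apply: khinchine => //.
  - exact: filter_uniq.
  - by move=> i; rewrite mem_filter => /andP[_ ir]; apply/rem_uniq/uS.
  - move=> i; rewrite mem_filter => /andP[_ ir] w /mem_rem; exact: Sl.
  - move=> i j; rewrite !mem_filter => /andP[vi ir] /andP[vj jr] ij.
    have [w wij] := dS i j ir jr ij; exists w.
      by case: (boolP (w \in S i)) wij => [/Sl -> //|_]; case: (boolP (w \in S j)) => [/Sl -> |].
    rewrite !mem_rem_uniq ?uS // !inE; case: (eqVneq w v) wij => [->|_] //=.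
    by rewrite vi vj.
  - move=> i; rewrite mem_filter => /andP[_ ir]; apply: leq_trans (deg i ir).
    by apply: size_subseq; apply: rem_subseq.
rewrite rsumZ -sgnE_sum Rmult_assoc; apply: Rmult_le_compat_l => //.
rewrite -[X in _ <= X](sgnE_cst l (C * M) y0); apply: sgnE_le => y off on.
apply: (gradient_bound HC) => // v; case: (boolP (v \in l)) => [/on|/off ->].
  by case=> ->; rewrite ?Rabs_Ropp Rabs_R1; lra.
by rewrite /y0 Rabs_R0; lra.
Qed.

(** * From mixed norms to Lorentz sums *)

Lemma pow_le_inv n a b : (0 < n)%nat -> 0 <= a -> 0 <= b -> a ^ n <= b ^ n -> a <= b.
Proof.
move=> n0 a0 b0 h; case: (Rle_lt_dec a b) => // ba; exfalso.
suff : b ^ n < a ^ n by lra.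
case: n n0 {h} => // n _; elim: n => [|n IH]; first by rewrite /= !Rmult_1_r.
by apply: Rmult_le_0_lt_compat => //; apply: (pow_le b n.+1).
Qed.

Lemma pow_diff_le n a b : 0 <= b <= a ->
  a ^ n.+1 - b ^ n.+1 <= INR n.+1 * a ^ n * (a - b).
Proof.
move=> [b0 ba]; elim: n => [|n IH]; first by rewrite /=; lra.
have := pow_incr b a n.+1 (conj b0 ba).
have -> : a ^ n.+2 - b ^ n.+2 = a * (a ^ n.+1 - b ^ n.+1) + b ^ n.+1 * (a - b).
  by rewrite /=; ring.
have -> : INR n.+2 * a ^ n.+1 * (a - b) = a * (INR n.+1 * a ^ n * (a - b)) + a ^ n.+1 * (a - b).
  by rewrite (S_INR n.+1) -[a ^ n.+1]/(a * a ^ n); ring.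
by move: (a ^ n.+1) (b ^ n.+1) IH => x y; move: (INR _ * _ * _) => z; nra.
Qed.

Section Root.
Variable m : nat.
Hypothesis m0 : (0 < m)%nat.

(** The m-th root, with 0 treated apart because [Rpower] is positive everywhere. *)
Definition rt (c : nat) : R :=
  if c is 0%nat then 0 else Rpower (INR c) (/ INR m).

Lemma rt_ge0 c : 0 <= rt c.
Proof. by case: c => [|c] /=; [lra|apply/Rlt_le/exp_pos]. Qed.

Lemma INRm0 : 0 < INR m.
Proof. by apply: lt_0_INR; apply/ltP. Qed.

Lemma rt_pow c : rt c ^ m = INR c.
Proof.
case: c => [|c]; first by rewrite /= pow_i //; apply/ltP.
have c0 : 0 < INR c.+1 by apply: lt_0_INR; apply/ltP.
rewrite /rt -Rpower_pow; last exact: exp_pos.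
rewrite Rpower_mult Rinv_l ?Rpower_1 //.
by have := INRm0; lra.
Qed.

Lemma rt_le a b : (a <= b)%nat -> rt a <= rt b.
Proof.
move=> ab; apply: (pow_le_inv m0); try exact: rt_ge0.
by rewrite !rt_pow; apply: le_INR; apply/leP.
Qed.

Lemma rt_expn c : rt (c ^ m)%nat = INR c.
Proof.
have pw n : INR (c ^ n)%nat = INR c ^ n.
  by elim: n => // n IH; rewrite expnS mult_INR IH.
by apply: Rle_antisym; apply: (pow_le_inv m0);
  rewrite ?rt_pow ?pw; try lra; try exact: rt_ge0; exact: pos_INR.
Qed.

(* (j+1)^(-(m-1)/m) *)
Definition gw (j : nat) : R := / rt j.+1 ^ m.-1.

Lemma gw_gt0 j : 0 < gw j.
Proof. by apply/Rinv_0_lt_compat/pow_lt/exp_pos. Qed.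

Lemma gw_le i j : (i <= j)%nat -> gw j <= gw i.
Proof.
move=> ij; apply: Rinv_le_contravar; first by apply/pow_lt/exp_pos.
by apply: pow_incr; split; [apply: rt_ge0|apply: rt_le].
Qed.

(** Discrete derivative of the m-th root: 1 = rt(j+1)^m - rt(j)^m is at most m rt(j+1)^(m-1) times
    the increment. *)
Lemma gw_telescope j : gw j <= INR m * (rt j.+1 - rt j).
Proof.
have pos : 0 < rt j.+1 ^ m.-1 by apply/pow_lt/exp_pos.
apply: (Rmult_le_reg_r (rt j.+1 ^ m.-1)) => //.
rewrite /gw Rinv_l; last by lra.
have := @pow_diff_le m.-1 (rt j.+1) (rt j).
rewrite !prednK // !rt_pow S_INR => /(_ (conj (rt_ge0 j) (rt_le (leqnSn j)))).
by lra.
Qed.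

(** Since [gw] decreases, a sparse set of indices is worst when pushed to the front, where the sum
    telescopes. *)
Lemma gw_sum (b : pred nat) K :
  \sum_(0 <= j < K | b j) gw j <= INR m * rt (count b (iota 0 K)).
Proof.
elim: K => [|K IH]; first by rewrite big_nil /=; lra.
have iotaS : iota 0 K.+1 = iota 0 K ++ [:: K] by rewrite -addn1 iotaD.
rewrite iotaS count_cat big_mkcond big_nat_recr //= -[in X in X <= _]big_mkcond /=.
rewrite addn0; case: ifP => bK; last by rewrite addn0 Rplus_0_r.
rewrite addn1; apply: Rle_trans (Rplus_le_compat_r _ _ _ IH) _.
have cK : (count b (iota 0 K) <= K)%nat.
  by rewrite -[X in (_ <= X)%nat](size_iota 0 K) count_size.
by have := gw_telescope (count b (iota 0 K)); have := gw_le cK; lra.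
Qed.

Definition posb (x : R) : bool := Rlt_dec 0 x.

Lemma posbP x : reflect (0 < x) (posb x).
Proof. by rewrite /posb; case: (Rlt_dec 0 x) => h /=; constructor. Qed.

(** A product may be listed several times; for counting, only the length |P|^k is needed. *)
Fixpoint words (k : nat) (P : seq nat) : seq nat :=
  if k is k'.+1 then [seq (p * q)%nat | p <- P, q <- words k' P] else [:: 1%nat].

Lemma size_words k P : size (words k P) = (size P ^ k)%nat.
Proof. by elim: k => //= k IH; rewrite size_allpairs IH expnS. Qed.

Lemma mem_words t P : {subset t <= P} ->
  (\big[muln/1%nat]_(p <- t) p)%nat \in words (size t) P.
Proof.
elim: t => [|p t IH] tP /=; first by rewrite big_nil inE.
rewrite big_cons; apply: allpairs_f; first by apply: tP; rewrite mem_head.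
by apply: IH => q qt; apply: tP; rewrite inE qt orbT.
Qed.

Lemma exists_min (Y : nat -> R) (P : seq nat) : P != [::] ->
  exists2 p, p \in P & forall q, q \in P -> Y p <= Y q.
Proof.
elim: P => // p [|p' P] IH _.
  by exists p; rewrite ?mem_head // => q; rewrite inE => /eqP ->; lra.
have [//|q qP qmin] := IH; case: (Rle_lt_dec (Y p) (Y q)) => h.
  exists p; first by rewrite mem_head.
  by move=> z; rewrite inE => /predU1P[->|/qmin]; lra.
exists q; first by rewrite inE qP orbT.
by move=> z; rewrite inE => /predU1P[->|/qmin]; lra.
Qed.

(* Layer-cake argument: lower all positive Y p by their least value v. The
   numbers n with U n > 0 are products of m elements of {p | Y p > 0}, hence
   there are at most #{p | Y p > 0}^m of them. *)
Lemma weighted_layers (P ns : seq nat) (Y U : nat -> R) : uniq ns ->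
  (forall p, p \in P -> 0 <= Y p) ->
  (forall n, 0 <= U n) ->
  (forall n, n \in ns -> 0 < U n -> exists2 t, size t = m &
     n = (\big[muln/1%nat]_(p <- t) p)%nat /\ forall p, p \in t -> p \in P /\ U n <= Y p) ->
  \sum_(0 <= j < size ns) (gw j * U (nth 0%nat ns j)) <= INR m * \sum_(p <- P) Y p.
Proof.
move=> uns; have [k] := ubnP (count (fun p => posb (Y p)) P).
elim: k Y U => // k IH Y U; rewrite ltnS => cnt Y0 U0 dec.
pose P1 := [seq p <- P | posb (Y p)].
case: (eqVneq P1 [::]) => [P1nil|P1n].
  rewrite big_nat_cond big1 => [|j /andP[/andP[_ jn] _]].
    apply: Rmult_le_pos; first by have := INRm0; lra.
    by apply: rsum_ge0 => p pP _; apply: Y0.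
  suff -> : U (nth 0%nat ns j) = 0 by ring.
  case: (Rle_lt_or_eq_dec _ _ (U0 (nth 0%nat ns j))) => // Upos.
  have [t sz [_ tP]] := dec _ (mem_nth _ jn) Upos.
  case: t sz tP => [sz|p t sz tP]; first by move: m0; rewrite -sz.
  have [pP Up] := tP p (mem_head _ _).
  suff : p \in P1 by rewrite P1nil.
  by rewrite mem_filter pP andbT; apply/posbP; exact: Rlt_le_trans Up.
have [p0 p0P vmin] := exists_min Y P1n.
set v := Y p0 in vmin.
have := p0P; rewrite mem_filter => /andP[/posbP vpos p0P2].
have {}vpos : 0 < v by [].
pose Y' p := if posb (Y p) then Y p - v else Y p.
pose U' n := Rmax (U n - v) 0.
have vle p : p \in P -> posb (Y p) -> v <= Y p.
  by move=> pP pos; apply: vmin; rewrite mem_filter pos.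
have IH' : \sum_(0 <= j < size ns) (gw j * U' (nth 0%nat ns j)) <= INR m * \sum_(p <- P) Y' p.
  apply: IH.
  (* The minimizer [p0] leaves the positive set, so the induction measure drops. *)
  - apply: leq_trans cnt; rewrite -!size_filter.
    have -> : [seq p <- P | posb (Y' p)] = [seq p <- P1 | posb (Y' p)].
      rewrite -filter_predI; apply: eq_in_filter => p pP /=.
      rewrite /Y'; case: ifP => [|/negbT]; rewrite ?andbT // => /negbTE ->; exact/esym/andbF.
    rewrite -/P1 size_filter -[X in (_ < X)%nat](count_predC (fun p => posb (Y' p)) P1).
    rewrite -addn1 leq_add2l -has_count; apply/hasP; exists p0 => //=.
    apply/posbP; rewrite /Y'; case: ifP => [_|/posbP //]; rewrite /v; lra.
  - move=> p pP; rewrite /Y'; case: ifP => pos; last exact: Y0.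
    by have := vle p pP pos; lra.
  - by move=> n; apply: Rmax_r.
  - move=> n nns; rewrite /U' => Upos.
    have vU : v < U n by move: Upos; rewrite /Rmax; case: (Rle_dec _ _) => ? /=; lra.
    have [t sz [nt tP]] := dec n nns ltac:(lra); exists t => //; split=> // p pt.
    have [pP Up] := tP p pt; split=> //.
    rewrite Rmax_left; last by lra.
    by rewrite /Y'; case: ifP => [_|/posbP]; lra.
have lay : \sum_(0 <= j < size ns | posb (U (nth 0%nat ns j))) gw j <= INR m * INR (size P1).
  apply: Rle_trans (gw_sum (fun j => posb (U (nth 0%nat ns j))) (size ns)) _.
  apply: Rmult_le_compat_l; first by have := INRm0; lra.
  rewrite -rt_expn; apply: rt_le; rewrite -size_words.
  have -> : count (fun j => posb (U (nth 0%nat ns j))) (iota 0 (size ns)) =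
      size [seq n <- ns | posb (U n)].
    rewrite size_filter -[X in _ = count _ X](mkseq_nth 0%nat ns) /mkseq count_map.
    by apply: eq_count.
  apply: uniq_leq_size; first exact: filter_uniq.
  move=> n; rewrite mem_filter => /andP[/posbP Upos nns].
  have [t sz [nE tP]] := dec n nns Upos; rewrite nE -sz; apply: mem_words => p pt.
  have [pP Up] := tP p pt; rewrite mem_filter pP andbT; apply/posbP.
  exact: Rlt_le_trans Upos Up.
have YE : \sum_(p <- P) Y p = \sum_(p <- P) Y' p + v * INR (size P1).
  have -> : v * INR (size P1) = \sum_(p <- P | posb (Y p)) v.
    rewrite /P1; elim: (P) => [|p s IHs]; first by rewrite big_nil /=; ring.
    rewrite big_cons; rewrite [filter _ _]/=; case: ifP => [_|_ //]; rewrite -IHs.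
    by rewrite -[LHS]/(v * INR (size [seq p <- s | posb (Y p)]).+1) S_INR; ring.
  rewrite [in X in _ = _ + X]big_mkcond -big_split /=; apply: eq_bigr => p _.
  by rewrite /Y'; case: ifP; lra.
(* Truncation at 0 loses at most [v], and only at indices where U is positive. *)
have UE : \sum_(0 <= j < size ns) (gw j * U (nth 0%nat ns j)) <=
    \sum_(0 <= j < size ns) (gw j * U' (nth 0%nat ns j)) +
    v * \sum_(0 <= j < size ns | posb (U (nth 0%nat ns j))) gw j.
  rewrite -rsumZ [in X in _ <= _ + X]big_mkcond -big_split /=; apply: rsum_le => j _ _.
  have := gw_gt0 j; rewrite /U'; case: ifP => pos; last first.
    move/negbT/posbP: pos; have := U0 (nth 0%nat ns j).
    by have := Rmax_r (U (nth 0%nat ns j) - v) 0; nra.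
  by have := Rmax_l (U (nth 0%nat ns j) - v) 0; nra.
rewrite YE; have := INRm0; nra.
Qed.

Lemma rsum_subset (I : eqType) (s1 s2 : seq I) (F : I -> R) : uniq s1 -> uniq s2 ->
  {subset s1 <= s2} -> (forall i, i \in s2 -> 0 <= F i) ->
  \sum_(i <- s1) F i <= \sum_(i <- s2) F i.
Proof.
move=> u1 u2 s12 F0; rewrite [X in _ <= X](bigID (mem s1)) /= -[X in _ <= X + _]big_filter.
rewrite (perm_big [seq i <- s2 | i \in s1]) /=; last first.
  apply: uniq_perm => // [|i]; first exact: filter_uniq.
  by rewrite mem_filter; case: (boolP (i \in s1)) => //= /s12 ->.
have : 0 <= \sum_(i <- s2 | i \notin s1) F i by apply: rsum_ge0 => i i2 _; apply: F0.
by lra.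
Qed.

(** Starting the fold at the value of the head keeps a foreign default from capping the minimum of a
    nonempty list. *)
Definition minY (Y : nat -> R) (t : seq nat) : R :=
  foldr (fun p a => Rmin (Y p) a) (Y (head 0%nat t)) t.

Lemma minYP Y t : t != [::] ->
  (exists2 p, p \in t & minY Y t = Y p) /\ (forall p, p \in t -> minY Y t <= Y p).
Proof.
move=> tn; rewrite /minY.
have ht : head 0%nat t \in t by case: (t) tn => // p s _; rewrite mem_head.
move: (head _ _) ht => h ht; split; last first.
  elim: (t) => // p s IH q; rewrite inE /= => /predU1P[->|/IH]; first exact: Rmin_l.
  by apply: Rle_trans; apply: Rmin_r.
suff [|[p pt ->]] : foldr (fun p : nat => Rmin (Y p)) (Y h) t = Y h \/
    exists2 p, p \in t & foldr (fun p : nat => Rmin (Y p)) (Y h) t = Y p.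
- by move=> ->; exists h.
- by exists p.
elim: (t) => [|p s IH] /=; first by left.
rewrite {1 3}/Rmin; case: Rle_dec => _ /=; first by right; exists p; rewrite ?mem_head.
case: IH => [->|[q qs ->]]; first by left.
by right; exists q; rewrite // inE qs orbT.
Qed.

(* Pair 2 |b| w <= b^2 / U + w^2 U with U n = min_{p in t n} Y p: the first
   terms sum up to at most \sum_p Y p, the second ones are weighted_layers. *)
Lemma lorentz_from_mixed (P r ns : seq nat) (b w : nat -> R) (t : nat -> seq nat) :
  uniq r -> uniq ns ->
  (forall n, n \in r -> {subset t n <= P} /\ exists2 s, size s = m &
     n = (\big[muln/1%nat]_(p <- s) p)%nat /\ {subset s <= t n}) ->
  (forall j, w j ^ 2 <= gw j) ->
  \sum_(0 <= j < size ns | nth 0%nat ns j \in r) (Rabs (b (nth 0%nat ns j)) * w j) <=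
  (1 + INR m) / 2 * \sum_(p <- P) sqrt (\sum_(n <- r | p \in t n) b n ^ 2).
Proof.
move=> ur uns tP wg.
pose Y p := sqrt (\sum_(n <- r | p \in t n) b n ^ 2).
rewrite -[X in _ * X]/(\sum_(p <- P) Y p).
have Y0 p : 0 <= Y p by apply: sqrt_pos.
have tn n : n \in r -> t n != [::].
  move=> /tP[_ [s sz [_ st]]]; apply: contraTneq m0 => tn0; rewrite -sz.
  by case: (s) st => // p s' /(_ p (mem_head _ _)); rewrite tn0.
(* Vanishing coefficients are excluded so that every U n used as a denominator is positive. *)
pose good n := (n \in r) && posb (Rabs (b n)).
pose U n := if good n then minY Y (t n) else 0.
have bY n p : n \in r -> p \in t n -> Rabs (b n) <= Y p.
  move=> nr pt; rewrite -sqrt_Rsqr_abs; apply: sqrt_le_1_alt; rewrite /Rsqr.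
  rewrite (big_rem n nr) /= pt -[X in X <= _]Rplus_0_r; apply: Rplus_le_compat; first by lra.
  by apply: rsum_ge0 => i _ _; nra.
have lay : \sum_(0 <= j < size ns) (gw j * U (nth 0%nat ns j)) <= INR m * \sum_(p <- P) Y p.
  apply: weighted_layers => //.
    move=> n; rewrite /U; case: ifP => [/andP[nr _]|_]; last by lra.
    by have [[p _ ->] _] := minYP Y (tn n nr).
  move=> n _; rewrite /U; case: ifP => [/andP[nr _]|_]; last by lra.
  move=> _; have [sub [s sz [nE st]]] := tP n nr; exists s => //; split=> // p /st pt.
  by split; [apply: sub|have [_] := minYP Y (tn n nr); apply].
have sq : \sum_(0 <= j < size ns | good (nth 0%nat ns j))
    (b (nth 0%nat ns j) ^ 2 / U (nth 0%nat ns j)) <= \sum_(p <- P) Y p.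
  rewrite -(big_nth 0%nat good (fun n => b n ^ 2 / U n)).
  (* The quotient by the minimum is one of the quotients by Y p, hence at most their sum over p in
     [t n]. After exchanging sums each p collects at most Y p ^ 2 / Y p. *)
  apply: (Rle_trans _ (\sum_(n <- ns | good n) \sum_(p <- P | p \in t n) (b n ^ 2 * / Y p))).
    apply: rsum_le => n _ gn; have /andP[nr /posbP bpos] := gn.
    rewrite /U gn; have [[p pt ->] _] := minYP Y (tn n nr).
    have [sub _] := tP n nr.
    rewrite (big_rem p (sub _ pt)) /= pt -[X in X <= _]Rplus_0_r; apply: Rplus_le_compat; first by rewrite /Rdiv; lra.
    apply: rsum_ge0 => q _ qt.
    apply: Rmult_le_pos; first exact: pow2_ge_0.
    by apply/Rlt_le/Rinv_0_lt_compat; have := bY n q nr qt; lra.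
  rewrite (exchange_big_dep predT) //=; apply: rsum_le => p _ _.
  rewrite -big_distrl /= -[X in _ <= X](_ : Y p ^ 2 * / Y p = _); last first.
    case: (Req_dec (Y p) 0) => [->|h]; last by field.
    by rewrite /=; ring.
  apply: Rmult_le_compat_r.
    case: (Rle_lt_or_eq_dec _ _ (Y0 p)) => [h|<-]; last by rewrite Rinv_0; lra.
    by apply/Rlt_le/Rinv_0_lt_compat.
  rewrite /Y pow2_sqrt; last by apply: rsum_ge0 => n _ _; apply: pow2_ge_0.
  rewrite -big_filter -[X in _ <= X]big_filter; apply: rsum_subset.
  - exact: filter_uniq.
  - exact: filter_uniq.
  - by move=> n; rewrite !mem_filter => /andP[/andP[/andP[-> _] ->] _].
  - by move=> n _; apply: pow2_ge_0.
apply: (Rle_trans _ (/ 2 * (\sum_(0 <= j < size ns | good (nth 0%nat ns j))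
    (b (nth 0%nat ns j) ^ 2 / U (nth 0%nat ns j)) +
    \sum_(0 <= j < size ns) (gw j * U (nth 0%nat ns j))))); last first.
  by lra.
rewrite big_mkcond [X in _ <= _ * (X + _)]big_mkcond -big_split -rsumZ /=.
apply: rsum_le => j _ _; set n := nth _ _ _.
rewrite /good; case: (boolP (n \in r)) => nr /=; last first.
  by rewrite /U /good (negbTE nr) /=; lra.
case: posbP => bpos; last first.
  have -> : Rabs (b n) = 0 by have := Rabs_pos (b n); lra.
  rewrite /U /good nr /=; case: posbP => //; lra.
have Upos : 0 < U n.
  rewrite /U /good nr; case: posbP => //= _.
  by have [[p pt ->] _] := minYP Y (tn n nr); have := bY n p nr pt; lra.
have key : b n ^ 2 / U n + w j ^ 2 * U n - 2 * (Rabs (b n) * w j) = (Rabs (b n) - w j * U n) ^ 2 / U n.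
  by rewrite -(pow2_abs (b n)); field; lra.
have : 0 <= (Rabs (b n) - w j * U n) ^ 2 / U n.
  apply: Rmult_le_pos; first exact: pow2_ge_0.
  exact/Rlt_le/Rinv_0_lt_compat.
by have := wg j; nra.
Qed.

End Root.

(** * Riesz product kernels *)

Section Kernel.
Variables (m : nat) (z : nat -> nat -> R).

(* k = (s, (a, b)) stands for the term (prod_((p, j) in s) z p j) cos (t ln (a / b));
   expanding the product over p in ps of 1 + 2 sum_(1 <= j <= m) z p j cos (j t ln p)
   yields the terms listed in [kernel ps]. *)
Fixpoint kernel (ps : seq nat) : seq (seq (nat * nat) * (nat * nat)) :=
  if ps is p :: ps' then
    flatten [seq k :: flatten
      [seq [:: ((p, j) :: k.1, ((k.2.1 * p ^ j)%nat, k.2.2));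
               ((p, j) :: k.1, (k.2.1, (k.2.2 * p ^ j)%nat))] | j <- iota 1 m]
      | k <- kernel ps']
  else [:: ([::], (1%nat, 1%nat))].

Definition wt (k : seq (nat * nat) * (nat * nat)) : R := \prod_(v <- k.1) z v.1 v.2.

Lemma wt_cons p j k ab : wt ((p, j) :: k.1, ab) = z p j * wt k.
Proof. by rewrite /wt big_cons. Qed.

Lemma kernel_sum p ps (F : seq (nat * nat) * (nat * nat) -> R) :
  \sum_(k <- kernel (p :: ps)) F k =
  \sum_(k <- kernel ps) (F k + \sum_(1 <= j < m.+1)
    (F ((p, j) :: k.1, ((k.2.1 * p ^ j)%nat, k.2.2)) +
     F ((p, j) :: k.1, (k.2.1, (k.2.2 * p ^ j)%nat)))).
Proof.
rewrite /= big_flatten big_map; apply: eq_bigr => k _.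
rewrite big_cons big_flatten big_map /index_iota subn1; congr (_ + _).
by apply: eq_bigr => j _; rewrite !big_cons big_nil /= Rplus_0_r.
Qed.

(** Numerators and denominators involve only primes of [ps], so the exponent of a new prime can be
    read off in the inductions below. *)
Lemma kernel_val ps k : all prime ps -> k \in kernel ps ->
  [/\ 0 < k.2.1, 0 < k.2.2 & forall q, prime q -> q \notin ps ->
     logn q k.2.1 = 0 /\ logn q k.2.2 = 0]%nat.
Proof.
elim: ps k => [|p ps IH] k /=.
  by move=> _; rewrite inE => /eqP ->; split=> // q _ _; rewrite logn1.
move=> /andP[pp pps] /flattenP[s /mapP[k0 k0K ->]].
have [a0 b0 val] := IH k0 pps k0K.
have pj j : (0 < p ^ j)%nat by rewrite expn_gt0 prime_gt0.
rewrite inE => /predU1P[->|/flattenP[s' /mapP[j _ ->]]].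
  by split=> // q qp; rewrite inE => /norP[_]; apply: val.
have val' q : prime q -> q \notin p :: ps -> logn q (p ^ j) = 0%nat.
  move=> qp; rewrite inE => /norP[/negbTE qn _].
  by rewrite lognX logn_prime // qn muln0.
rewrite !inE => /orP[] /eqP -> /=; split=> //; rewrite ?muln_gt0 ?a0 ?b0 ?pj //;
  move=> q qp qn; rewrite !lognM // val' // addn0; apply: val => //;
  by move: qn; rewrite inE => /norP[].
Qed.

Lemma INR_gt0 n : (0 < n)%nat -> 0 < INR n.
Proof. by move=> n0; apply: lt_0_INR; apply/ltP. Qed.

Definition freq (k : seq (nat * nat) * (nat * nat)) : R := ln (INR k.2.1) - ln (INR k.2.2).

Lemma ln_mulX a p j : (0 < a)%nat -> (0 < p)%nat ->
  ln (INR (a * p ^ j)) = ln (INR a) + INR j * ln (INR p).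
Proof.
move=> a0 p0; have pw : INR (p ^ j)%nat = INR p ^ j.
  by elim: j => // j IH; rewrite expnS mult_INR IH.
by rewrite mult_INR ln_mult ?pw ?ln_pow //; try apply: pow_lt; exact: INR_gt0.
Qed.

(** The two terms added for (p, j) have frequencies shifted by + and - j ln p, and cos(x+y) +
    cos(x-y) = 2 cos x cos y factors them. *)
Lemma kernel_cos ps t : all prime ps ->
  \sum_(k <- kernel ps) (wt k * cos (t * freq k)) =
  \prod_(p <- ps) (1 + 2 * \sum_(1 <= j < m.+1) (z p j * cos (INR j * (t * ln (INR p))))).
Proof.
elim: ps => [|p ps IH] /=.
  by move=> _; rewrite big_seq1 /wt !big_nil /freq /= ln_1 Rminus_0_r Rmult_0_r cos_0; ring.
move=> /andP[pp pps]; rewrite kernel_sum big_cons -IH // -rsumZ.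
apply: eq_big_seq => k kK; have [a0 b0 _] := kernel_val pps kK.
rewrite Rmult_plus_distr_r Rmult_1_l; congr (_ + _).
rewrite -rsumZ big_distrl /=; apply: eq_bigr => j _.
rewrite !wt_cons /freq /= !ln_mulX ?(prime_gt0 pp) //=.
have -> : t * (ln (INR k.2.1) + INR j * ln (INR p) - ln (INR k.2.2)) =
  t * (ln (INR k.2.1) - ln (INR k.2.2)) + INR j * (t * ln (INR p)) by ring.
have -> : t * (ln (INR k.2.1) - (ln (INR k.2.2) + INR j * ln (INR p))) =
  t * (ln (INR k.2.1) - ln (INR k.2.2)) - INR j * (t * ln (INR p)) by ring.
rewrite cos_plus cos_minus.
by move: (cos _) (sin _) (cos (INR j * _)) (sin (INR j * _)) (wt k) (z p j) => *; ring.
Qed.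

(** The same pairing factors the sine sum down to sin 0. It removes the sine part of the Dirichlet
    series when averaging against the kernel. *)
Lemma kernel_sin ps t : all prime ps ->
  \sum_(k <- kernel ps) (wt k * sin (t * freq k)) = 0.
Proof.
elim: ps => [|p ps IH] /=.
  by move=> _; rewrite big_seq1 /wt big_nil /freq /= ln_1 Rminus_0_r Rmult_0_r sin_0; ring.
move=> /andP[pp pps]; rewrite kernel_sum.
transitivity ((1 + 2 * \sum_(1 <= j < m.+1) (z p j * cos (INR j * (t * ln (INR p))))) *
  \sum_(k <- kernel ps) (wt k * sin (t * freq k))); last by rewrite IH // Rmult_0_r.
rewrite -[RHS]rsumZ.
apply: eq_big_seq => k kK; have [a0 b0 _] := kernel_val pps kK.
rewrite Rmult_plus_distr_r Rmult_1_l; congr (_ + _).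
rewrite -rsumZ big_distrl /=; apply: eq_bigr => j _.
rewrite !wt_cons /freq /= !ln_mulX ?(prime_gt0 pp) //=.
have -> : t * (ln (INR k.2.1) + INR j * ln (INR p) - ln (INR k.2.2)) =
  t * (ln (INR k.2.1) - ln (INR k.2.2)) + INR j * (t * ln (INR p)) by ring.
have -> : t * (ln (INR k.2.1) - (ln (INR k.2.2) + INR j * ln (INR p))) =
  t * (ln (INR k.2.1) - ln (INR k.2.2)) - INR j * (t * ln (INR p)) by ring.
rewrite sin_plus sin_minus.
by move: (cos _) (sin _) (cos (INR j * _)) (sin (INR j * _)) (wt k) (z p j) => *; ring.
Qed.

(** Each Riesz factor is at least 1 - 2 m / (2m) = 0; this is the origin of the size restriction on
    z. *)
Lemma kernel_ge0 ps t : all prime ps ->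
  (forall p j, 2 * INR m * Rabs (z p j) <= 1) ->
  0 <= \sum_(k <- kernel ps) (wt k * cos (t * freq k)).
Proof.
move=> pps z1; rewrite kernel_cos //.
apply: (big_ind (Rle 0)) => [|x y|p _]; [lra|exact: Rmult_le_pos|].
have : Rabs (\sum_(1 <= j < m.+1) (z p j * cos (INR j * (t * ln (INR p))))) <= / 2.
  apply: Rle_trans (Rabs_rsum _ _ _) _.
  case: (posnP m) => [->|m0]; first by rewrite big_nil; lra.
  have m0' := INR_gt0 m0.
  have -> : / 2 = \sum_(1 <= j < m.+1) (/ (2 * INR m)).
    rewrite big_const_nat subn1 /=.
    have -> : iter m (Rplus (/ (2 * INR m))) 0 = INR m * / (2 * INR m).
      move: (/ _) => x; elim: (m) => [|n IHn]; first by rewrite /=; ring.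
      by rewrite S_INR /= IHn; ring.
    by field; lra.
  apply: rsum_le => j _ _; rewrite Rabs_mult.
  have := COS_bound (INR j * (t * ln (INR p))) => cb.
  have : Rabs (cos (INR j * (t * ln (INR p)))) <= 1 by apply: Rabs_le; lra.
  have : Rabs (z p j) <= / (2 * INR m).
    apply: (Rmult_le_reg_l (2 * INR m)); first by lra.
    by rewrite Rinv_r; [apply: z1|lra].
  have := Rabs_pos (z p j); have := Rabs_pos (cos (INR j * (t * ln (INR p)))).
  by nra.
move: (\sum_(1 <= j < m.+1) _) => x /Rabs_le_between; lra.
Qed.

(** The resonance condition n b = a is compared prime by prime. If p does not divide n, neither a
    nor b may contain p; if p has exponent e in n, then a must have received p^e, which is listed
    because e <= m. The sum thus reduces to the remaining primes. *)
Lemma kernel_coef ps n : all prime ps -> uniq ps -> (0 < n)%nat ->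
  (forall p, logn p n <= m)%nat ->
  \sum_(k <- kernel ps | (n * k.2.2 == k.2.1)%nat) wt k =
  if all (mem ps) (primes n) then \prod_(p <- primes n) z p (logn p n) else 0.
Proof.
elim: ps n => [|p ps IH] n /=.
  move=> _ _ n0 _; rewrite big_cons big_nil /= muln1.
  case: eqVneq => [->|n1] /=; first by rewrite /wt !big_nil Rplus_0_r.
  case: (primes n) (primes_eq0 n) => //=; case: n n0 n1 => [|[]] //.
move=> /andP[pp pps] /andP[pn ups] n0 nm.
rewrite big_mkcond kernel_sum /=.
have pj j : (0 < p ^ j)%nat by rewrite expn_gt0 prime_gt0.
have vpj j : logn p (p ^ j) = j by rewrite pfactorK.
case: (posnP (logn p n)) => [e0|e_gt0].
  transitivity (\sum_(k <- kernel ps | (n * k.2.2 == k.2.1)%nat) wt k).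
    rewrite [RHS]big_mkcond; apply: eq_big_seq => k kK.
    rewrite big_nat big1 ?Rplus_0_r // => j /andP[j1 _].
    have [a0 b0 /(_ p pp pn)[va vb]] := kernel_val pps kK.
    case: eqP => [/(congr1 (logn p)) /=|_].
      by rewrite !lognM ?pj // vpj e0 va vb !add0n => h; rewrite -h in j1.
    case: eqP => [/(congr1 (logn p)) /=|_]; last by ring.
    by rewrite !lognM ?muln_gt0 ?b0 ?pj // vpj e0 va vb !add0n => h; rewrite h in j1.
  rewrite IH //; congr (if _ then _ else _); apply: eq_in_all => q qn /=.
  rewrite inE; case: eqVneq => // qp; move: qn.
  by rewrite -logn_gt0 qp e0.
pose e := logn p n; pose n' := n`_p^'.
have nE : n = (n' * p ^ e)%nat by rewrite mulnC -p_part partnC.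
have n'0 : (0 < n')%nat by apply: part_gt0.
have vn' q : logn q n' = if q == p then 0%nat else logn q n.
  have : logn q n = (logn q n' + e * (q == p))%nat.
    rewrite {1}nE lognM ?pj // lognX (logn_prime q pp) //.
  case: eqVneq => [->|_]; last by rewrite muln0 addn0.
  by rewrite muln1 -/e => h; apply/eqP; rewrite -(eqn_add2r e) -h.
transitivity (z p e * \sum_(k <- kernel ps | (n' * k.2.2 == k.2.1)%nat) wt k).
  rewrite -rsumZ [RHS]big_mkcond; apply: eq_big_seq => k kK.
  have [a0 b0 /(_ p pp pn)[va vb]] := kernel_val pps kK.
  have -> : (n * k.2.2 == k.2.1)%nat = false.
    apply/eqP => /(congr1 (logn p)); rewrite lognM // va vb addn0 => h.
    by rewrite h in e_gt0.
  rewrite Rplus_0_l (bigD1_seq e) ?iota_uniq ?mem_index_iota //=; last first.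
    by rewrite e_gt0 ltnS nm.
  have nb j : (n * (k.2.2 * p ^ j) == k.2.1)%nat = false.
    apply/eqP => /(congr1 (logn p)); rewrite !lognM ?muln_gt0 ?b0 ?pj // va vb => h.
    by move/eqP: h; rewrite addn_eq0 => /andP[/eqP h _]; rewrite h in e_gt0.
  have na j : (n * k.2.2 == k.2.1 * p ^ j)%nat = (j == e) && (n' * k.2.2 == k.2.1)%nat.
    case: (eqVneq j e) => [->|je] /=.
      by rewrite {1}nE mulnAC eqn_pmul2r.
    apply/eqP => /(congr1 (logn p)); rewrite !lognM // vpj va vb addn0 add0n => h.
    by rewrite -h eqxx in je.
  rewrite na nb eqxx Rplus_0_r /= big1 => [|j je].
    by rewrite wt_cons Rplus_0_r; case: ifP.
  by rewrite na nb (negbTE je) Rplus_0_r.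
rewrite IH //; last by move=> q; rewrite vn'; case: ifP.
have pnP : p \in primes n by rewrite -logn_gt0.
have prn : perm_eq (primes n) (p :: primes n').
  apply: uniq_perm; rewrite ?primes_uniq //=.
    by rewrite primes_uniq andbT -logn_gt0 vn' eqxx.
  move=> q; rewrite inE -!logn_gt0 vn'; case: eqVneq => [->|] //=.
rewrite (perm_all _ prn) /= inE eqxx /= (perm_big _ prn) big_cons /= -/e.
have -> : all (mem (p :: ps)) (primes n') = all (mem ps) (primes n').
  apply: eq_in_all => q qn /=; rewrite inE; case: eqVneq => // qp; move: qn.
  by rewrite -logn_gt0 vn' qp eqxx.
case: ifP => _; last by rewrite Rmult_0_r.
congr (_ * _); apply: eq_big_seq => q qn; rewrite vn'; case: eqVneq => // qp.
by move: qn; rewrite -logn_gt0 vn' qp eqxx.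
Qed.

End Kernel.

(** * Uniform bounds for partial sums of Dirichlet series *)

Lemma ln_INR_le n k : (0 < n)%nat -> (n <= k)%nat -> ln (INR n) <= ln (INR k).
Proof.
move=> n0 nk; apply: ln_le; first by apply: lt_0_INR; apply/ltP.
by apply: le_INR; apply/leP.
Qed.

(** The phase moves by at most T (v - u), while exp(-wu) - exp(-wv) is at least d (v - u) exp(-wv).
    The variation is thus dominated by that of a monotone function, and such bounds telescope. *)
Lemma pow_phase_diff (g : R -> R) (T d w t u v : R) :
  (forall x, Rabs (g x) <= 1) -> (forall x y, Rabs (g x - g y) <= Rabs (x - y)) ->
  0 < d -> d <= w -> Rabs t <= T -> u <= v ->
  Rabs (exp (- w * u) * g (t * u) - exp (- w * v) * g (t * v)) <=
  (1 + T / d) * (exp (- w * u) - exp (- w * v)).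
Proof.
move=> g1 gL d0 dw tT uv.
set A := exp (- w * u); set B := exp (- w * v).
have B0 : 0 < B by apply: exp_pos.
have AB : B * (d * (v - u)) <= A - B.
  have -> : A = B * exp (w * (v - u)) by rewrite /A /B -exp_plus; congr exp; ring.
  have := exp_ineq1_le (w * (v - u)) => h.
  have : d * (v - u) <= w * (v - u) by nra.
  by nra.
have T0 : 0 <= T by have := Rabs_pos t; lra.
have P0 : 0 <= B * (d * (v - u)).
  by apply: Rmult_le_pos; nra.
have -> : A * g (t * u) - B * g (t * v) = (A - B) * g (t * u) + B * (g (t * u) - g (t * v)) by ring.
apply: Rle_trans (Rabs_triang _ _) _; rewrite !Rabs_mult (Rabs_pos_eq B) ?(Rabs_pos_eq (A - B)); try lra.
have h1 : (A - B) * Rabs (g (t * u)) <= A - B.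
  by have := g1 (t * u); have := Rabs_pos (g (t * u)); nra.
have h2 : B * Rabs (g (t * u) - g (t * v)) <= T / d * (A - B).
  apply: (Rle_trans _ (T / d * (B * (d * (v - u))))); last first.
    apply: Rmult_le_compat_l => //; apply: Rmult_le_pos => //.
    exact/Rlt_le/Rinv_0_lt_compat.
  have -> : T / d * (B * (d * (v - u))) = B * (T * (v - u)) by field; lra.
  apply: Rmult_le_compat_l; first lra.
  apply: Rle_trans (gL _ _) _.
  have -> : t * u - t * v = - (t * (v - u)) by ring.
  rewrite Rabs_Ropp Rabs_mult (Rabs_pos_eq (v - u)); last lra.
  by apply: Rmult_le_compat_r; lra.
by lra.
Qed.

Section Dirichlet.
Variables (al : nat -> R) (M : R).

(** For real coefficients, [g] = cos gives the real part of the partial sum at x + it, and [g] = sin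
    the imaginary part up to sign. *)
Definition dpart (g : R -> R) (N : nat) (x t : R) : R :=
  \sum_(1 <= n < N) (al n * (Rpower (INR n) (- x) * g (t * ln (INR n)))).

Definition bounded_lim (g : R -> R) : Prop := forall x t, 0 < x ->
  exists2 l, is_lim_seq (fun N => dpart g N x t) (Rbar.Finite l) & Rabs l <= M.

Hypothesis Hcos : bounded_lim cos.

(** Abel summation against the convergent series at the real point sg / 2: the remaining factor has
    bounded variation, uniformly for x >= sg and |t| <= T. Hence the cosine hypothesis serves both
    phases. *)
Lemma dpart_abel g (sg T : R) :
  (forall x, Rabs (g x) <= 1) -> (forall x y, Rabs (g x - g y) <= Rabs (x - y)) ->
  0 < sg -> 0 <= T -> forall e, 0 < e -> exists N0, forall N N' x t, (N0 <= N)%nat -> (N <= N')%nat ->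
  sg <= x -> Rabs t <= T -> Rabs (dpart g N' x t - dpart g N x t) <= e.
Proof.
move=> g1 gL sg0 T0 e e0.
pose d := sg / 2; have d0 : 0 < d by rewrite /d; lra.
pose D := 1 + T / d.
have D1 : 1 <= D.
  rewrite /D; have : 0 <= T / d; last by lra.
  by apply: Rmult_le_pos => //; apply/Rlt_le/Rinv_0_lt_compat.
(* The boundary term costs eta and the summed variation eta D. *)
pose eta := e / (1 + D).
have eta0 : 0 < eta by apply: Rdiv_lt_0_compat; lra.
have [l lim _] := Hcos 0 d0.
have eta2 : 0 < eta / 2 by lra.
move/is_lim_seq_spec: lim => /(_ (mkposreal _ eta2)) [N0 HN0].
exists (maxn N0 1) => N N' x t; rewrite geq_max => /andP[N0N N1] NN' sgx tT.
pose B k := dpart cos k d 0.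
have RB k : (N <= k)%nat -> Rabs (B k - B N) <= eta.
  move=> Nk; have := HN0 k; have := HN0 N.
  move=> /(_ ltac:(by apply/leP)) /= hN /(_ ltac:(by apply/leP; apply: leq_trans Nk)) /= hk.
  have -> : B k - B N = (B k - l) - (B N - l) by ring.
  apply: Rle_trans (Rabs_triang _ _) _; rewrite Rabs_Ropp /B; lra.
pose w := x - d.
pose ph n := exp (- w * ln (INR n)) * g (t * ln (INR n)).
have ph1 n : (0 < n)%nat -> Rabs (ph n) <= 1.
  move=> n0; rewrite /ph Rabs_mult (Rabs_pos_eq (exp _)); last exact/Rlt_le/exp_pos.
  have : exp (- w * ln (INR n)) <= 1.
    rewrite -exp_0; have ln0 : 0 <= ln (INR n) by rewrite -ln_1; apply: (@ln_INR_le 1).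
    case: (Rle_lt_or_eq_dec _ _ ln0) => [h|<-]; last by rewrite Rmult_0_r; lra.
    by apply/Rlt_le/exp_increasing; rewrite /w /d in d0 *; nra.
  have := exp_pos (- w * ln (INR n)); have := g1 (t * ln (INR n)).
  by have := Rabs_pos (g (t * ln (INR n))); nra.
(* Summation by parts, one index at a time, with the telescoped variation on the right. *)
have main k : (N <= k)%nat ->
    Rabs (dpart g k x t - dpart g N x t - (B k - B N) * ph k) <=
    eta * D * (exp (- w * ln (INR N)) - exp (- w * ln (INR k))).
  elim: k => [|k IH]; first by rewrite leqn0 => /eqP h; rewrite h in N1.
  rewrite leq_eqVlt => /predU1P[<-|].
    by rewrite !Rminus_diag Rmult_0_l Rminus_0_r Rabs_R0 Rmult_0_r; lra.
  rewrite ltnS => Nk; have k0 : (0 < k)%nat by apply: leq_trans Nk.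
  have termE : al k * (Rpower (INR k) (- x) * g (t * ln (INR k))) = (B k.+1 - B k) * ph k.
    rewrite /B /dpart big_nat_recr //= Rmult_0_l cos_0 /ph /Rpower.
    have -> : - x * ln (INR k) = - d * ln (INR k) + - w * ln (INR k) by rewrite /w; ring.
    by rewrite exp_plus; ring.
  have -> : dpart g k.+1 x t = dpart g k x t + (B k.+1 - B k) * ph k.
    by rewrite /dpart big_nat_recr //= -termE.
  have -> : dpart g k x t + (B k.+1 - B k) * ph k - dpart g N x t - (B k.+1 - B N) * ph k.+1 =
    (dpart g k x t - dpart g N x t - (B k - B N) * ph k) + (B k.+1 - B N) * (ph k - ph k.+1) by ring.
  apply: Rle_trans (Rabs_triang _ _) _; rewrite Rabs_mult.
  have st : Rabs (ph k - ph k.+1) <= D * (exp (- w * ln (INR k)) - exp (- w * ln (INR k.+1))).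
    apply: pow_phase_diff => //; last exact: ln_INR_le.
    by rewrite /w /d; lra.
  have := IH Nk; have := RB k.+1 (leqW Nk); have := Rabs_pos (B k.+1 - B N).
  have := Rabs_pos (ph k - ph k.+1).
  set a := exp _; set b := exp _ in st *; set f := exp _ => p1 p2 p3 p4.
  have : Rabs (B k.+1 - B N) * Rabs (ph k - ph k.+1) <= eta * (D * (b - f)).
    by apply: Rmult_le_compat.
  by lra.
have N'0 : (0 < N')%nat by apply: leq_trans NN'.
have {}main := main _ NN'.
have : Rabs ((B N' - B N) * ph N') <= eta.
  rewrite Rabs_mult; have := RB _ NN'; have := ph1 _ N'0.
  by have := Rabs_pos (ph N'); have := Rabs_pos (B N' - B N); nra.
have eN : exp (- w * ln (INR N)) <= 1.
  rewrite -exp_0; have ln0 : 0 <= ln (INR N) by rewrite -ln_1; apply: (@ln_INR_le 1).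
  case: (Rle_lt_or_eq_dec _ _ ln0) => [h|<-]; last by rewrite Rmult_0_r; lra.
  by apply/Rlt_le/exp_increasing; rewrite /w /d in d0 *; nra.
have eE : e = eta * (1 + D) by rewrite /eta; field; lra.
have := exp_pos (- w * ln (INR N')).
have := Rabs_triang (dpart g N' x t - dpart g N x t - (B N' - B N) * ph N') ((B N' - B N) * ph N').
have -> : dpart g N' x t - dpart g N x t - (B N' - B N) * ph N' + (B N' - B N) * ph N' =
  dpart g N' x t - dpart g N x t by ring.
move=> p1 p2 p3; have : eta * D * (exp (- w * ln (INR N)) - exp (- w * ln (INR N'))) <= eta * D * 1.
  by apply: Rmult_le_compat_l; nra.
by lra.
Qed.

(** The limit is at most M in absolute value; the uniform Cauchy bound and the pointwise convergence
    add 1/2 each. Only the comparison index depends on (x, t). *)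
Lemma dpart_bound g (sg T : R) :
  (forall x, Rabs (g x) <= 1) -> (forall x y, Rabs (g x - g y) <= Rabs (x - y)) ->
  bounded_lim g -> 0 < sg -> 0 <= T ->
  exists N0, forall N x t, (N0 <= N)%nat -> sg <= x -> Rabs t <= T -> Rabs (dpart g N x t) <= M + 1.
Proof.
move=> g1 gL Hg sg0 T0.
have half : 0 < / 2 by lra.
have [N0 HN0] := dpart_abel g1 gL sg0 T0 half.
exists N0 => N x t N0N sgx tT.
have x0 : 0 < x by lra.
have [l lim lM] := Hg x t x0.
move/is_lim_seq_spec: lim => /(_ (mkposreal _ half)) [N1 HN1].
have := HN0 N (maxn N N1) x t N0N (leq_maxl _ _) sgx tT.
have /= := HN1 (maxn N N1) ltac:(by apply/leP; apply: leq_maxr).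
set a := dpart g _ x t; set b := dpart g N x t => h1 h2.
have -> : b = l + (a - l) + - (a - b) by ring.
apply: Rle_trans (Rabs_triang _ _) _; rewrite Rabs_Ropp.
by have := Rabs_triang l (a - l); lra.
Qed.

(** Convergence at abscissa 1 bounds |a_n| / n, as a difference of bounded partial sums. Two further
    units of abscissa leave the sum of 1 / n^2, controlled by the telescoping 2 - 1 / k. *)
Lemma abs_sum3 : exists A, forall N, \sum_(1 <= n < N) (Rabs (al n) * Rpower (INR n) (-3)) <= A.
Proof.
have [l lim lM] := Hcos 0 Rlt_0_1.
have [A [A0 HA]] : exists A, 0 <= A /\ forall n, (0 < n)%nat -> Rabs (al n) * Rpower (INR n) (-1) <= A.
  have [B HB] : exists B, forall N, Rabs (dpart cos N 1 0) <= B.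
    have [N0 HN0] : exists N0, forall N, (N0 <= N)%nat -> Rabs (dpart cos N 1 0) <= M + 1.
      move/is_lim_seq_spec: lim => /(_ (mkposreal _ Rlt_0_1)) [N1 HN1].
      exists N1 => N N1N; have /= := HN1 N ltac:(by apply/leP).
      move=> h; have -> : dpart cos N 1 0 = l + (dpart cos N 1 0 - l) by ring.
      by apply: Rle_trans (Rabs_triang _ _) _; lra.
    elim: N0 HN0 => [|N0 IH] HN0; first by exists (M + 1) => N; apply: HN0.
    exists (Rmax (M + 1) (\sum_(0 <= j < N0.+1) Rabs (dpart cos j 1 0))) => N.
    case: (leqP N0.+1 N) => [/HN0|]; first by have := Rmax_l (M + 1) (\sum_(0 <= j < N0.+1) Rabs (dpart cos j 1 0)); lra.
    move=> NN0; apply: Rle_trans (Rmax_r _ _).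
    rewrite (bigD1_seq N) ?mem_index_iota ?iota_uniq //=.
    have : 0 <= \sum_(0 <= i < N0.+1 | i != N) Rabs (dpart cos i 1 0) by apply: rsum_ge0 => *; apply: Rabs_pos.
    by lra.
  exists (2 * B); split; first by have := HB 0%nat; have := Rabs_pos (dpart cos 0 1 0); lra.
  move=> n n0; have := HB n; have := HB n.+1.
  have -> : dpart cos n.+1 1 0 = dpart cos n 1 0 + al n * Rpower (INR n) (-1).
    rewrite /dpart big_nat_recr //= Rmult_0_l cos_0 (_ : - (1) = -1); last by lra.
    by rewrite Rmult_1_r.
  move: (dpart _ _ _ _) => s h1 h2.
  rewrite -(Rabs_pos_eq (Rpower _ _)); last exact/Rlt_le/exp_pos.
  rewrite -Rabs_mult; move: (al n * _) h1 => y h1.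
  have -> : y = (s + y) + - s by ring.
  by apply: Rle_trans (Rabs_triang _ _) _; rewrite Rabs_Ropp; lra.
exists (2 * A) => N.
suff h k : \sum_(1 <= n < k.+2) (Rabs (al n) * Rpower (INR n) (-3)) <= A * (2 - / INR k.+1).
  case: N => [|[|N]]; try by rewrite big_nil; lra.
  apply: Rle_trans (h N) _; have : 0 < / INR N.+1 by apply/Rinv_0_lt_compat/lt_0_INR/ltP.
  by nra.
have st n : (0 < n)%nat -> Rabs (al n) * Rpower (INR n) (-3) <= A * / (INR n * INR n).
  move=> n0; have n0' : 0 < INR n by apply: lt_0_INR; apply/ltP.
  have -> : Rpower (INR n) (-3) = Rpower (INR n) (-1) * / (INR n * INR n).
    have -> : -3 = -1 + - INR 2 by rewrite /=; ring.
    by rewrite Rpower_plus Rpower_Ropp Rpower_pow //= Rmult_1_r.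
  rewrite -Rmult_assoc; apply: Rmult_le_compat_r; last exact: HA.
  by apply/Rlt_le/Rinv_0_lt_compat; nra.
elim: k => [|k IH].
  rewrite big_nat1; apply: Rle_trans (st 1%nat isT) _.
  by rewrite /= Rmult_1_r Rinv_1; lra.
rewrite big_nat_recr //; apply: Rle_trans (Rplus_le_compat _ _ _ _ IH (st k.+2 isT)) _.
have -> : A * (2 - / INR k.+1) + A * / (INR k.+2 * INR k.+2) = A * (2 - / INR k.+1 + / (INR k.+2 * INR k.+2)) by ring.
apply: Rmult_le_compat_l => //; rewrite !(S_INR k.+1).
have x0 : 0 < INR k.+1 by apply: lt_0_INR; apply/ltP.
move: (INR k.+1) x0 => x x0.
have -> : 2 - / (x + 1) = 2 - / x + / (x * (x + 1)) by field; lra.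
have : / ((x + 1) * (x + 1)) <= / (x * (x + 1)) by apply: Rinv_le_contravar; nra.
by lra.
Qed.

End Dirichlet.

(** * Shifting the line of integration *)

Lemma is_RInt_rsum (I : Type) (r : seq I) (f : I -> R -> R) (l : I -> R) a b :
  (forall i, is_RInt (f i) a b (l i)) ->
  is_RInt (fun t => \sum_(i <- r) f i t) a b (\sum_(i <- r) l i).
Proof.
move=> fl; elim: r => [|i r IH].
  rewrite big_nil; apply: (is_RInt_ext (fun=> 0)) => [x _|]; first by rewrite big_nil.
  have := @is_RInt_const R_NormedModule a b 0; rewrite /scal /= /mult /= Rmult_0_r; exact.
rewrite big_cons; apply: (is_RInt_ext (fun t => f i t + \sum_(i <- r) f i t)) => [x _|].
  by rewrite big_cons.
exact: is_RInt_plus.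
Qed.

Lemma is_derive_rsum (I : Type) (r : seq I) (f : I -> R -> R) (l : I -> R) x :
  (forall i, is_derive (f i) x (l i)) ->
  is_derive (fun t => \sum_(i <- r) f i t) x (\sum_(i <- r) l i).
Proof.
move=> fl; elim: r => [|i r IH].
  rewrite big_nil; apply: (is_derive_ext (fun=> 0)) => [t|]; first by rewrite big_nil.
  exact: is_derive_const.
rewrite big_cons; apply: (is_derive_ext (fun t => f i t + \sum_(i <- r) f i t)) => [t|].
  by rewrite big_cons.
exact: is_derive_plus.
Qed.

(** Mean of cos(tv) over 0 <= t <= T: it detects v = 0 as T grows. *)
Definition kap (T v : R) : R := if Req_dec_T v 0 then 1 else sin (T * v) / (T * v).

Lemma kap_RInt T v : 0 < T -> is_RInt (fun t => cos (t * v)) 0 T (T * kap T v).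
Proof.
move=> T0; rewrite /kap; case: (Req_dec_T v 0) => v0 /=.
  apply: (is_RInt_ext (fun=> 1)) => [x _|]; first by rewrite v0 Rmult_0_r cos_0.
  have := @is_RInt_const R_NormedModule 0 T 1; rewrite /scal /= /mult /= Rminus_0_r; exact.
have -> : T * (sin (T * v) / (T * v)) = minus (sin (T * v) / v) (sin (0 * v) / v).
  by rewrite /minus /plus /opp /= Rmult_0_l sin_0; field; lra.
apply: (is_RInt_derive (fun t => sin (t * v) / v)) => t _.
  by auto_derive => //; field.
apply: continuous_comp; last exact: continuous_cos.
by apply: (continuous_mult id); [apply: continuous_id|apply: continuous_const].
Qed.

Lemma kap_le T v k : 0 < T -> 0 < k -> k <= Rabs v -> Rabs (kap T v) <= / (T * k).
Proof.
move=> T0 k0 kv; rewrite /kap; case: (Req_dec_T v 0) => [v0|v0] /=.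
  by move: kv; rewrite v0 Rabs_R0; lra.
rewrite /Rdiv Rabs_mult Rabs_inv Rabs_mult (Rabs_pos_eq T); last by lra.
have : / (T * Rabs v) <= / (T * k) by apply: Rinv_le_contravar; nra.
have : 0 < / (T * Rabs v) by apply: Rinv_0_lt_compat; nra.
have := SIN_bound (T * v) => sb.
have : Rabs (sin (T * v)) <= 1 by apply: Rabs_le.
have := Rabs_pos (sin (T * v)).
by nra.
Qed.

(** The factor -v produced by differentiation cancels the denominator of [kap], so small frequencies
    do no harm. This is Cauchy's theorem on a rectangle in real form: what remains is the edge at
    height T, divided by T. *)
Lemma kap_derive T v s x : 0 < T ->
  is_derive (fun x => exp (- (x - s) * v) * kap T v) x (- (exp (- (x - s) * v) * sin (T * v)) / T).
Proof.
move=> T0; rewrite /kap; case: (Req_dec_T v 0) => v0 /=.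
  by auto_derive => //; rewrite v0 !Rmult_0_r sin_0; field; lra.
by auto_derive => //; rewrite /Rminus; field; lra.
Qed.

Lemma Rabs_cos_le1 x : Rabs (cos x) <= 1.
Proof. by apply: Rabs_le; have := COS_bound x. Qed.
Lemma Rabs_sin_le1 x : Rabs (sin x) <= 1.
Proof. by apply: Rabs_le; have := SIN_bound x. Qed.

Lemma lipschitz_of_derive (f f' : R -> R) : (forall x, is_derive f x (f' x)) ->
  (forall x, Rabs (f' x) <= 1) -> forall x y, Rabs (f x - f y) <= Rabs (x - y).
Proof.
move=> df f1 x y.
have [z [_ ->]] := @MVT_gen f y x f' (fun z _ => df z)
  (fun z _ => derivable_continuous_pt _ _ (ex_derive_Reals_0 _ _ (ex_intro _ _ (df z)))).
rewrite Rabs_mult; have := f1 z; have := Rabs_pos (x - y); nra.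
Qed.

Lemma cos_lip x y : Rabs (cos x - cos y) <= Rabs (x - y).
Proof.
apply: (@lipschitz_of_derive cos (fun x => - sin x)) => z.
  by auto_derive => //; ring.
by rewrite Rabs_Ropp; apply: Rabs_sin_le1.
Qed.

Lemma sin_lip x y : Rabs (sin x - sin y) <= Rabs (x - y).
Proof.
apply: (@lipschitz_of_derive sin cos) => z; last exact: Rabs_cos_le1.
by auto_derive => //; ring.
Qed.

Section ContourShift.
Variables (al : nat -> R) (M : R).
Hypotheses (Hcos : bounded_lim al M cos) (Hsin : bounded_lim al M sin).
Variables (I : eqType) (K : seq I) (c u : I -> R) (e : nat -> I -> bool).
Variable kp : R.
Hypotheses
  (Qge0 : forall t, 0 <= \sum_(k <- K) (c k * cos (t * u k)))
  (Qsin : forall t, \sum_(k <- K) (c k * sin (t * u k)) = 0)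
  (kp0 : 0 < kp)
  (He : forall n k, (0 < n)%nat -> k \in K ->
     if e n k then ln (INR n) = u k else kp <= Rabs (ln (INR n) - u k)).

(** Bounds the kernel continued over a horizontal distance of at most 3, the length of the shift. *)
Let Xi := \sum_(k <- K) (Rabs (c k) * exp (3 * Rabs (u k))).

(* The average over [0, T] of the partial sum at abscissa s times the kernel,
   continued analytically to abscissa x. *)
Let W N T s x := \sum_(1 <= n < N) \sum_(k <- K)
  (al n * Rpower (INR n) (- s) * c k *
   (exp (- (x - s) * (ln (INR n) - u k)) * kap T (ln (INR n) - u k))).

(** At x = s, T times [W] is a true integral of partial sum times kernel, the sine part vanishing by
    [Qsin]. Positivity of the kernel lets the bound M + 1 pass through the integral. *)
Lemma W_left N T s : 0 < T ->
  (forall t, 0 <= t <= T -> Rabs (dpart al cos N s t) <= M + 1) ->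
  Rabs (W N T s s) <= (M + 1) * \sum_(k <- K) (c k * kap T (u k)).
Proof.
move=> T0 hM.
pose f t := \sum_(1 <= n < N) \sum_(k <- K)
  (al n * Rpower (INR n) (- s) * c k * cos (t * (ln (INR n) - u k))).
have fE t : f t = dpart al cos N s t * \sum_(k <- K) (c k * cos (t * u k)).
  have -> : f t = dpart al cos N s t * \sum_(k <- K) (c k * cos (t * u k)) +
     dpart al sin N s t * \sum_(k <- K) (c k * sin (t * u k)).
    rewrite /dpart !big_distrl -big_split /=; apply: eq_bigr => n _.
    rewrite !big_distrr -big_split /=; apply: eq_bigr => k _.
    by rewrite Rmult_minus_distr_l cos_minus; ring.
  by rewrite Qsin; ring.
have fI : is_RInt f 0 T (T * W N T s s).
  have -> : T * W N T s s = \sum_(1 <= n < N) \sum_(k <- K)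
     (al n * Rpower (INR n) (- s) * c k * (T * kap T (ln (INR n) - u k))).
    rewrite /W -rsumZ; apply: eq_bigr => n _; rewrite -rsumZ; apply: eq_bigr => k _.
    by rewrite Rminus_diag Ropp_0 Rmult_0_l exp_0; ring.
  apply: is_RInt_rsum => n; apply: is_RInt_rsum => k.
  by apply: (@is_RInt_scal R_NormedModule); apply: kap_RInt.
have QI : is_RInt (fun t => (M + 1) * \sum_(k <- K) (c k * cos (t * u k))) 0 T
   ((M + 1) * (T * \sum_(k <- K) (c k * kap T (u k)))).
  have -> : T * \sum_(k <- K) (c k * kap T (u k)) = \sum_(k <- K) (c k * (T * kap T (u k))).
    by rewrite -rsumZ; apply: eq_bigr => k _; ring.
  apply: (@is_RInt_scal R_NormedModule); apply: is_RInt_rsum => k.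
  by apply: (@is_RInt_scal R_NormedModule); apply: kap_RInt.
have T0' : 0 <= T by lra.
have up : T * W N T s s <= (M + 1) * (T * \sum_(k <- K) (c k * kap T (u k))).
  apply: (is_RInt_le _ _ _ _ _ _ T0' fI QI) => t tT; rewrite fE.
  apply: Rmult_le_compat_r => //; have := hM t ltac:(lra).
  by move/Rabs_le_between; lra.
have fIn : is_RInt (fun t => opp (f t)) 0 T (opp (T * W N T s s)) by apply: is_RInt_opp.
have lo : - (T * W N T s s) <= (M + 1) * (T * \sum_(k <- K) (c k * kap T (u k))).
  apply: (is_RInt_le _ _ _ _ _ _ T0' fIn QI) => t tT; rewrite /opp /= fE Ropp_mult_distr_l.
  apply: Rmult_le_compat_r => //; have := hM t ltac:(lra).
  by move/Rabs_le_between; lra.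
apply: (Rmult_le_reg_l T) => //.
rewrite -{1}(Rabs_pos_eq T) // -Rabs_mult; apply: Rabs_le; lra.
Qed.

(** Mean value theorem in the abscissa: the derivative is at most 2 (M + 1) Xi / T, and the path is
    no longer than 3. *)
Lemma W_shift N T s : 0 < T -> 0 < s <= 1 ->
  (forall x, s <= x -> Rabs (dpart al cos N x T) <= M + 1) ->
  (forall x, s <= x -> Rabs (dpart al sin N x T) <= M + 1) ->
  Rabs (W N T s 3 - W N T s s) <= 6 * (M + 1) * Xi / T.
Proof.
move=> T0 s1 hc hs.
pose W' x := \sum_(1 <= n < N) \sum_(k <- K)
  (al n * Rpower (INR n) (- s) * c k *
   (- (exp (- (x - s) * (ln (INR n) - u k)) * sin (T * (ln (INR n) - u k))) / T)).
have dW x : is_derive (W N T s) x (W' x).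
  apply: is_derive_rsum => n; apply: is_derive_rsum => k.
  by apply: (is_derive_scal (fun x => exp (- (x - s) * (ln (INR n) - u k)) * kap T (ln (INR n) - u k))); apply: kap_derive.
(* Here n^(-s) and exp(-(x-s) ln n) recombine into n^(-x), so the derivative is made of partial sums
   at x + iT, where the uniform bounds apply. *)
have W'E x : W' x = - / T * (dpart al sin N x T * \sum_(k <- K) (c k * (exp ((x - s) * u k) * cos (T * u k)))
   - dpart al cos N x T * \sum_(k <- K) (c k * (exp ((x - s) * u k) * sin (T * u k)))).
  rewrite /dpart !big_distrl -rsumB -rsumZ /=; apply: eq_bigr => n _.
  rewrite !big_distrr -rsumB -rsumZ /=; apply: eq_bigr => k _.
  rewrite (Rmult_minus_distr_l T) sin_minus /Rpower.
  have -> : - (x - s) * (ln (INR n) - u k) = (- x * ln (INR n)) + - (- s * ln (INR n)) + (x - s) * u k by ring.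
  rewrite !exp_plus exp_Ropp; have := exp_pos (- s * ln (INR n)); move: (exp (- s * _)) => E E0.
  by field; lra.
have M1 : 0 <= M + 1 by have := hc s ltac:(lra); have := Rabs_pos (dpart al cos N s T); lra.
have bnd (h : R -> R) x : (forall y, Rabs (h y) <= 1) -> s <= x <= 3 ->
   Rabs (\sum_(k <- K) (c k * (exp ((x - s) * u k) * h (T * u k)))) <= Xi.
  move=> h1 sx; apply: Rle_trans (Rabs_rsum _ _ _) _; apply: rsum_le => k _ _.
  rewrite !Rabs_mult; apply: Rmult_le_compat_l; first exact: Rabs_pos.
  rewrite (Rabs_pos_eq (exp _)); last exact/Rlt_le/exp_pos.
  have : exp ((x - s) * u k) <= exp (3 * Rabs (u k)).
    have : (x - s) * u k <= 3 * Rabs (u k).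
      by have := Rle_abs (u k); have := Rabs_pos (u k); nra.
    by case/Rle_lt_or_eq_dec => [/exp_increasing|->]; lra.
  have := exp_pos ((x - s) * u k); have := h1 (T * u k); have := Rabs_pos (h (T * u k)).
  by nra.
have [x [sx ->]] := @MVT_gen (W N T s) s 3 W' (fun z _ => dW z)
  (fun z _ => derivable_continuous_pt _ _ (ex_derive_Reals_0 _ _ (ex_intro _ _ (dW z)))).
rewrite Rmin_left ?Rmax_right in sx; try lra.
have Xi0 : 0 <= Xi.
  by apply: rsum_ge0 => k _ _; apply: Rmult_le_pos; [exact: Rabs_pos|exact/Rlt_le/exp_pos].
have W'le : Rabs (W' x) <= / T * (2 * (M + 1) * Xi).
  rewrite W'E Rabs_mult Rabs_Ropp Rabs_inv (Rabs_pos_eq T); last by lra.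
  apply: Rmult_le_compat_l; first by apply/Rlt_le/Rinv_0_lt_compat.
  apply: Rle_trans (Rabs_triang _ _) _; rewrite Rabs_Ropp !Rabs_mult.
  have := Rmult_le_compat _ _ _ _ (Rabs_pos _) (Rabs_pos _) (hc x ltac:(lra)) (bnd sin x Rabs_sin_le1 ltac:(lra)).
  have := Rmult_le_compat _ _ _ _ (Rabs_pos _) (Rabs_pos _) (hs x ltac:(lra)) (bnd cos x Rabs_cos_le1 ltac:(lra)).
  by lra.
rewrite Rabs_mult (Rabs_pos_eq (3 - s)); last by lra.
have -> : 6 * (M + 1) * Xi / T = / T * (2 * (M + 1) * Xi) * 3 by rewrite /Rdiv; ring.
by apply: Rmult_le_compat => //; [exact: Rabs_pos|lra|lra].
Qed.

(** For resonant pairs both the exponential and [kap] equal 1, which reproduces the main term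
    exactly. The other pairs carry at most 1 / (T kp) and n^(-3), so they sum up uniformly in N. *)
Lemma W_right A N T s : 0 < T -> 0 < s <= 1 ->
  \sum_(1 <= n < N) (Rabs (al n) * Rpower (INR n) (-3)) <= A ->
  Rabs (W N T s 3 - \sum_(1 <= n < N) (al n * Rpower (INR n) (- s) * \sum_(k <- K | e n k) c k))
    <= A * Xi / (T * kp).
Proof.
move=> T0 s1 hA; rewrite /W -rsumB.
apply: Rle_trans (Rabs_rsum _ _ _) _.
have Xi0 : 0 <= Xi / (T * kp).
  apply: Rmult_le_pos; last by apply/Rlt_le/Rinv_0_lt_compat; nra.
  by apply: rsum_ge0 => k _ _; apply: Rmult_le_pos; [exact: Rabs_pos|exact/Rlt_le/exp_pos].
apply: (Rle_trans _ (\sum_(1 <= n < N) (Xi / (T * kp) * (Rabs (al n) * Rpower (INR n) (-3))))); last first.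
  rewrite rsumZ; have -> : A * Xi / (T * kp) = Xi / (T * kp) * A by rewrite /Rdiv; ring.
  exact: Rmult_le_compat_l.
apply: rsum_le => n; rewrite mem_index_iota => /andP[n0 _] _.
rewrite -rsumZ [X in _ - X]big_mkcond -rsumB; apply: Rle_trans (Rabs_rsum _ _ _) _.
rewrite /Xi /Rdiv Rmult_assoc big_distrl /=.
apply: rsum_le => k kK _; have := He n0 kK; case: ifP => _.
  move=> nu; rewrite /kap nu Rminus_diag; case: (Req_dec_T 0 0) => //= _.
  rewrite Rmult_0_r exp_0 -[X in Rabs X](_ : 0 = _); last by ring.
  rewrite Rabs_R0; apply: Rmult_le_pos.
    by apply: Rmult_le_pos; [exact: Rabs_pos|exact/Rlt_le/exp_pos].
  apply: Rmult_le_pos; first by apply/Rlt_le/Rinv_0_lt_compat; nra.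
  by apply: Rmult_le_pos; [exact: Rabs_pos|exact/Rlt_le/exp_pos].
move=> kv; rewrite Rminus_0_r.
have kl := kap_le T0 kp0 kv.
have -> : al n * Rpower (INR n) (- s) * c k * (exp (- (3 - s) * (ln (INR n) - u k)) * kap T (ln (INR n) - u k)) =
   (al n * Rpower (INR n) (-3)) * (c k * exp ((3 - s) * u k)) * kap T (ln (INR n) - u k).
  rewrite /Rpower; have -> : - (3 - s) * (ln (INR n) - u k) = -3 * ln (INR n) + - (- s * ln (INR n)) + (3 - s) * u k by ring.
  rewrite !exp_plus exp_Ropp; have := exp_pos (- s * ln (INR n)); move: (exp (- s * _)) => E E0.
  by field; lra.
rewrite !Rabs_mult (Rabs_pos_eq (Rpower _ _)) ?(Rabs_pos_eq (exp _)); try exact/Rlt_le/exp_pos.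
have ex : exp ((3 - s) * u k) <= exp (3 * Rabs (u k)).
  have : (3 - s) * u k <= 3 * Rabs (u k).
    by have := Rle_abs (u k); have := Rabs_pos (u k); nra.
  by case/Rle_lt_or_eq_dec => [/exp_increasing|->]; lra.
have P0 : 0 <= Rabs (al n) * Rpower (INR n) (-3).
  by apply: Rmult_le_pos; [exact: Rabs_pos|exact/Rlt_le/exp_pos].
rewrite [X in _ <= X](_ : _ = Rabs (al n) * Rpower (INR n) (-3) * (Rabs (c k) * exp (3 * Rabs (u k))) * / (T * kp)); last by ring.
have Q0 : 0 <= Rabs (c k) * exp ((3 - s) * u k).
  by apply: Rmult_le_pos; [exact: Rabs_pos|exact/Rlt_le/exp_pos].
apply: Rmult_le_compat => //; [exact: Rmult_le_pos|exact: Rabs_pos|].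
by apply: Rmult_le_compat_l => //; apply: Rmult_le_compat_l => //; exact: Rabs_pos.
Qed.

(** Beyond N1 nothing resonates, so the left side does not see N, which may depend on T. The total
    error is H / T with H independent of both, and T is arbitrary. *)
Theorem coef_functional_bound (s : R) (N1 : nat) : 0 < s <= 1 -> (0 < N1)%nat ->
  (forall n k, (N1 <= n)%nat -> k \in K -> ~~ e n k) ->
  Rabs (\sum_(1 <= n < N1) (al n * Rpower (INR n) (- s) * \sum_(k <- K | e n k) c k)) <=
  (M + 1) * \sum_(k <- K | e 1%nat k) c k.
Proof.
move=> s1 N10 eN1; set Z := \sum_(1 <= n < N1) _.
have [A HA] := abs_sum3 Hcos.
have M1 : 0 <= M by have [l _ lM] := Hcos 0 Rlt_0_1; have := Rabs_pos l; lra.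
pose H := 6 * (M + 1) * Xi + A * Xi / kp + (M + 1) * (Xi / kp).
have key T : 0 < T -> Rabs Z <= (M + 1) * \sum_(k <- K | e 1%nat k) c k + H / T.
  move=> T0; have T0' : 0 <= T by lra.
  have s0 : 0 < s by lra.
  have [Nc HNc] := dpart_bound Hcos Rabs_cos_le1 cos_lip Hcos s0 T0'.
  have [Ns HNs] := dpart_bound Hcos Rabs_sin_le1 sin_lip Hsin s0 T0'.
  pose N := maxn N1 (maxn Nc Ns).
  have NN1 : (N1 <= N)%nat by apply: leq_maxl.
  have NNc : (Nc <= N)%nat by rewrite /N !leq_max leqnn orbT.
  have NNs : (Ns <= N)%nat by rewrite /N !leq_max leqnn !orbT.
  have ZE : Z = \sum_(1 <= n < N) (al n * Rpower (INR n) (- s) * \sum_(k <- K | e n k) c k).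
    rewrite (big_cat_nat N10 NN1) /= -/Z [X in _ = _ + X]big_nat_cond big1 ?Rplus_0_r // => n /andP[/andP[nN1 _] _].
    rewrite [X in _ * X]big_seq_cond big1 ?Rmult_0_r // => k /andP[kK ek].
    by have := eN1 n k nN1 kK; rewrite ek.
  have w1 : Rabs (W N T s s) <= (M + 1) * \sum_(k <- K) (c k * kap T (u k)).
    apply: W_left => // t tT; apply: HNc => //; first by lra.
    by rewrite Rabs_pos_eq; lra.
  have TT : Rabs T <= T by rewrite Rabs_pos_eq; lra.
  have w2 := @W_shift N T s T0 s1 (fun x sx => HNc N x T NNc sx TT) (fun x sx => HNs N x T NNs sx TT).
  have w3 := W_right T0 s1 (HA N); rewrite -ZE in w3.
  (* Since ln 1 = 0, resonance with n = 1 selects frequency 0: the sum is the mean value of the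
     kernel. *)
  have w4 : \sum_(k <- K) (c k * kap T (u k)) <= \sum_(k <- K | e 1%nat k) c k + Xi / (T * kp).
    rewrite [X in X + _]big_mkcond /Rdiv big_distrl -big_split /=.
    apply: rsum_le => k kK _; have := He (n := 1%nat) isT kK; rewrite /= ln_1.
    have E1 : 1 <= exp (3 * Rabs (u k)).
      by have := exp_ineq1_le (3 * Rabs (u k)); have := Rabs_pos (u k); lra.
    have Tk : 0 < / (T * kp) by apply: Rinv_0_lt_compat; nra.
    case: ifP => _ hu.
      rewrite /kap -hu; case: (Req_dec_T 0 0) => //= _.
      have : 0 <= Rabs (c k) * exp (3 * Rabs 0) * / (T * kp).
        apply: Rmult_le_pos; last by lra.
        by apply: Rmult_le_pos; [exact: Rabs_pos|exact/Rlt_le/exp_pos].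
      by lra.
    have {}hu : kp <= Rabs (u k) by move: hu; rewrite Rminus_0_l Rabs_Ropp.
    rewrite Rplus_0_l; apply: Rle_trans (Rle_abs _) _; rewrite Rabs_mult.
    have := kap_le T0 kp0 hu; have := Rabs_pos (kap T (u k)); have := Rabs_pos (c k).
    move: (Rabs (c k)) (Rabs (kap _ _)) (exp _) E1 (/ _) Tk => a b E E1 t t0 a0 b0 bt.
    have : a * b <= a * t by apply: Rmult_le_compat_l.
    have : 0 <= a * t by apply: Rmult_le_pos; lra.
    nra.
  have -> : Z = W N T s s + (W N T s 3 - W N T s s) + - (W N T s 3 - Z) by ring.
  apply: Rle_trans (Rabs_triang _ _) _; rewrite Rabs_Ropp.
  have := Rabs_triang (W N T s s) (W N T s 3 - W N T s s).
  have -> : H / T = 6 * (M + 1) * Xi / T + A * Xi / (T * kp) + (M + 1) * (Xi / (T * kp)).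
    by rewrite /H; field; lra.
  have : (M + 1) * \sum_(k <- K) (c k * kap T (u k)) <= (M + 1) * (\sum_(k <- K | e 1%nat k) c k + Xi / (T * kp)).
    by apply: Rmult_le_compat_l; lra.
  by lra.
case: (Rle_lt_dec (Rabs Z) ((M + 1) * \sum_(k <- K | e 1%nat k) c k)) => // lt.
set B := (M + 1) * _ in lt key.
have H0 : 0 < Rabs H + 1 by have := Rabs_pos H; lra.
(* For this T the error H / T is smaller than the supposed excess of |Z| over B. *)
have T0 : 0 < (Rabs H + 1) / (Rabs Z - B) by apply: Rdiv_lt_0_compat; lra.
have := key _ T0.
have -> : H / ((Rabs H + 1) / (Rabs Z - B)) = (Rabs Z - B) * (H / (Rabs H + 1)) by field; lra.
have : H / (Rabs H + 1) < 1.
  apply: (Rmult_lt_reg_r (Rabs H + 1)) => //.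
  rewrite /Rdiv Rmult_assoc Rinv_l; last by lra.
  by have := Rle_abs H; lra.
by nra.
Qed.

End ContourShift.

(** * Lorentz sums for real coefficients *)

Lemma sqrt_rsum_le (I : eqType) (r : seq I) (F : I -> R) : (forall i, 0 <= F i) ->
  sqrt (\sum_(i <- r) F i) <= \sum_(i <- r) sqrt (F i).
Proof.
move=> F0; elim: r => [|i r IH]; first by rewrite !big_nil sqrt_0; lra.
rewrite !big_cons; have s0 : 0 <= \sum_(j <- r) F j by apply: rsum_ge0.
apply: (Rle_trans _ (sqrt (F i) + sqrt (\sum_(j <- r) F j))); last by apply: Rplus_le_compat_l.
have a0 := sqrt_pos (F i); have b0 := sqrt_pos (\sum_(j <- r) F j).
have a2 := sqrt_sqrt _ (F0 i); have b2 := sqrt_sqrt _ s0.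
rewrite -[X in _ <= X](sqrt_Rsqr); last by lra.
by apply: sqrt_le_1_alt; rewrite /Rsqr /=; nra.
Qed.

Lemma ln_gap x a : (0 < x)%nat -> (0 < a)%nat -> x != a ->
  / (INR a + 1) <= Rabs (ln (INR x) - ln (INR a)).
Proof.
have step y b : 0 < b -> b + 1 <= y -> / (b + 1) <= ln y - ln b.
  move=> b0 by1; have : ln (b + 1) <= ln y by apply: ln_le; lra.
  have : / (b + 1) <= ln (b + 1) - ln b; last by lra.
  rewrite -ln_div; try lra.
  have := exp_ineq1_le (- ln ((b + 1) / b)); rewrite exp_Ropp exp_ln; last by apply: Rdiv_lt_0_compat; lra.
  have -> : / ((b + 1) / b) = 1 - / (b + 1) by field; lra.
  by lra.
move=> x0 a0; have x0' := INR_gt0 x0; have a0' := INR_gt0 a0.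
rewrite neq_ltn => /orP[xa|ax].
  have := step (INR a) (INR x) x0'; rewrite -S_INR => /(_ (le_INR x.+1 a ltac:(by apply/leP))).
  rewrite S_INR => h; rewrite Rabs_minus_sym; apply: Rle_trans (Rle_abs _).
  apply: Rle_trans h; apply: Rinv_le_contravar; first by lra.
  by have := lt_INR x a ltac:(by apply/ltP); lra.
have := step (INR x) (INR a) a0'; rewrite -S_INR => /(_ (le_INR a.+1 x ltac:(by apply/leP))).
by move=> h; apply: Rle_trans h (Rle_abs _).
Qed.

Lemma bound_at_0 (f : R -> R) B : continuity_pt f 0 ->
  (forall s, 0 < s <= 1 -> Rabs (f s) <= B) -> Rabs (f 0) <= B.
Proof.
move=> cf fB; case: (Rle_lt_dec (Rabs (f 0)) B) => // lt.
have [d [d0 hd]] := cf (Rabs (f 0) - B) ltac:(lra).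
pose s := Rmin (d / 2) 1.
have s01 : 0 < s <= 1 by rewrite /s; split; [apply: Rmin_glb_lt; lra|apply: Rmin_r].
have sd : s <= d / 2 by apply: Rmin_l.
have := hd s; rewrite /D_x /no_cond /dist /= /R_dist.
have h1 : (True /\ 0 <> s) /\ Rabs (s - 0) < d.
  by split; [split=> //; lra|rewrite Rminus_0_r Rabs_pos_eq; lra].
move=> /(_ h1); have := fB s s01; have := Rabs_triang (f s) (- (f s - f 0)).
rewrite Rabs_Ropp; have -> : f s + - (f s - f 0) = f 0 by ring.
by lra.
Qed.

(** * Integers as products of lists of primes *)

Definition prodn (s : seq nat) : nat := \big[muln/1%nat]_(p <- s) p.

Lemma prodn_gt0 s : all prime s -> (0 < prodn s)%nat.
Proof.
rewrite /prodn; elim: s => [|p s IH] /=; first by rewrite big_nil.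
by move=> /andP[/prime_gt0 p0 /IH]; rewrite big_cons muln_gt0 p0.
Qed.

Lemma logn_prodn s q : all prime s -> logn q (prodn s) = count_mem q s.
Proof.
elim: s => [|p s IH]; first by rewrite /prodn big_nil logn1.
move=> /= /andP[pp ps]; rewrite /prodn big_cons -/(prodn s).
by rewrite lognM ?(prime_gt0 pp) ?(prodn_gt0 ps) // IH // logn_prime // eq_sym.
Qed.

Lemma primes_prodn s : all prime s -> primes (prodn s) =i s.
Proof.
by move=> ps q; rewrite -logn_gt0 logn_prodn // -has_count has_pred1.
Qed.

Lemma size_primes_prodn s : all prime s -> (size (primes (prodn s)) <= size s)%nat.
Proof.
move=> ps; apply: uniq_leq_size; first exact: primes_uniq.
by move=> q; rewrite primes_prodn.
Qed.

Definition degree_eq (m n : nat) : Prop :=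
  exists2 s, size s = m & all prime s /\ n = prodn s.

Lemma words_degree m ps n : all prime ps -> n \in words m ps ->
  exists2 s, size s = m & [/\ all prime s, n = prodn s & {subset s <= ps}].
Proof.
move=> pps; elim: m n => [|m IH] n /=.
  by rewrite inE => /eqP ->; exists [::] => //; split=> //; rewrite /prodn big_nil.
move=> /allpairsP[[p q] /= [pp qw ->]].
have [s sz [prs -> sps]] := IH q qw; exists (p :: s); first by rewrite /= sz.
split; rewrite /= ?prs ?(allP pps) //; first by rewrite /prodn big_cons.
by move=> x; rewrite inE => /predU1P[->|/sps].
Qed.

Section RealCoefficients.
Variables (m : nat) (al : nat -> R) (M : R).
Hypotheses
  (Hcos : bounded_lim al M cos) (Hsin : bounded_lim al M sin)
  (Hdeg : forall n, (0 < n)%nat -> al n <> 0 -> degree_eq m n).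

(** The finite kernel makes n b = a a resonance with a positive spectral gap, and its mean value is
    1, the coefficient of n = 1. The bound is uniform in s, and the finite sum is continuous, so s
    may tend to 0. *)
Lemma monomial_sum_bound ps z : all prime ps -> uniq ps ->
  (forall p j, 2 * INR m * Rabs (z p j) <= 1) ->
  Rabs (\sum_(n <- undup (words m ps)) (al n * \prod_(p <- primes n) z p (logn p n))) <= M + 1.
Proof.
move=> pps ups hz; set r := undup _.
pose P n := \prod_(p <- primes n) z p (logn p n).
pose f s := \sum_(n <- r) (al n * Rpower (INR n) (- s) * P n).
have -> : \sum_(n <- r) (al n * P n) = f 0.
  apply: eq_big_seq => n; rewrite mem_undup => /(words_degree pps)[s _ [prs nE _]].
  rewrite Ropp_0 Rpower_O ?Rmult_1_r //; apply: INR_gt0; rewrite nE; exact: prodn_gt0.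
apply: bound_at_0.
  apply: derivable_continuous_pt; apply: ex_derive_Reals_0.
  exists (\sum_(n <- r) (al n * P n * - ln (INR n))); apply: is_derive_rsum => n.
  rewrite /Rpower; auto_derive => //; rewrite Ropp_0 Rmult_0_l exp_0; ring.
move=> s s01; pose K := kernel m ps.
pose A := (\max_(k <- K) k.2.1)%nat.
have KA k : k \in K -> (k.2.1 <= A)%nat.
  by move=> kK; rewrite /A (big_rem k) //= leq_maxl.
pose e n (k : seq (nat * nat) * (nat * nat)) := (n * k.2.2 == k.2.1)%nat.
(* Large enough both to exceed every numerator, hence every resonance, and to contain all of [r]. *)
pose N1 := (A + \sum_(n <- r) n).+1%nat.
have kp0 : 0 < / (INR A + 1) by apply: Rinv_0_lt_compat; have := pos_INR A; lra.
have He n k : (0 < n)%nat -> k \in K ->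
   if e n k then ln (INR n) = freq k else / (INR A + 1) <= Rabs (ln (INR n) - freq k).
  move=> n0 kK; have [a0 b0 _] := kernel_val pps kK; rewrite /e /freq.
  have lnM : ln (INR (n * k.2.2)) = ln (INR n) + ln (INR k.2.2).
    by rewrite mult_INR ln_mult //; apply: INR_gt0.
  case: eqVneq => [<-|ne]; first by rewrite lnM; symmetry; apply: Rplus_minus_r.
  have -> : ln (INR n) - (ln (INR k.2.1) - ln (INR k.2.2)) = ln (INR (n * k.2.2)) - ln (INR k.2.1).
    by rewrite lnM; ring.
  apply: Rle_trans (ln_gap _ a0 ne); last by rewrite muln_gt0 n0.
  apply: Rinv_le_contravar; first by have := pos_INR k.2.1; lra.
  by have := le_INR k.2.1 A ltac:(by apply/leP; apply: KA); lra.
have eN1 n k : (N1 <= n)%nat -> k \in K -> ~~ e n k.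
  move=> nN kK; have [a0 b0 _] := kernel_val pps kK.
  apply: contraTneq nN => ae; rewrite -ltnNge ltnS.
  apply: leq_trans (leq_trans (KA k kK) (leq_addr _ _)).
  by rewrite -ae leq_pmulr.
have := coef_functional_bound Hcos Hsin (c := wt z) (u := freq) (e := e) (kp := / (INR A + 1))
  (fun t => kernel_ge0 t pps hz) (fun t => kernel_sin m z t pps) kp0 He s01 (ltn0Sn _) eN1.
have -> : \sum_(k <- K | e 1%nat k) wt z k = 1.
  by rewrite (kernel_coef z pps ups (ltn0Sn 0)) ?big_nil // => p; rewrite logn1.
rewrite Rmult_1_r; congr (Rabs _ <= _).
have F0 n : (0 < n)%nat -> n \notin r ->
   al n * Rpower (INR n) (- s) * \sum_(k <- K | e n k) wt z k = 0.
  move=> n0 nr; case: (Req_dec (al n) 0) => [->|/(Hdeg n0)[t sz [prt nE]]]; first by ring.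
  rewrite kernel_coef //; last by move=> p; rewrite nE logn_prodn // -sz count_size.
  case: ifP => [/allP sub|_]; last by ring.
  case/negP: nr; rewrite mem_undup nE -sz; apply: mem_words => p pt.
  by apply: sub; rewrite nE primes_prodn.
transitivity (\sum_(n <- r) (al n * Rpower (INR n) (- s) * \sum_(k <- K | e n k) wt z k)).
  rewrite (bigID (mem r)) /= [X in _ + X](_ : _ = 0) ?Rplus_0_r; last first.
    by rewrite big_nat_cond big1 // => n /andP[/andP[n0 _] nr]; apply: F0.
  rewrite -big_filter; apply: perm_big; apply: uniq_perm.
  - by rewrite filter_uniq // iota_uniq.
  - exact: undup_uniq.
  move=> n; rewrite mem_filter mem_index_iota; case: (boolP (n \in r)) => //= nr.
  have n0 : (0 < n)%nat.
    by move: nr; rewrite mem_undup => /(words_degree pps)[t _ [prt -> _]]; apply: prodn_gt0.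
  by rewrite n0 ltnS /= (big_rem n nr) /= addnCA leq_addr.
apply: eq_big_seq => n nr.
have := nr; rewrite mem_undup => /(words_degree pps)[t sz [prt nE tps]].
have n0 : (0 < n)%nat by rewrite nE; apply: prodn_gt0.
rewrite kernel_coef //; last by move=> p; rewrite nE logn_prodn // -sz count_size.
rewrite (_ : all _ _) //; apply/allP => p; rewrite nE primes_prodn //; exact: tps.
Qed.

End RealCoefficients.

(** The finite list [ns] only determines which primes are used; the constant depends on [m] alone.
    It will be applied to near-maximal choices of indices. *)
Theorem lorentz_sum_bound m : (0 < m)%nat -> exists2 C, 0 <= C &
  forall (al : nat -> R) M, bounded_lim al M cos -> bounded_lim al M sin ->
  (forall n, (0 < n)%nat -> al n <> 0 -> degree_eq m n) ->
  forall (ns : seq nat) (w : nat -> R), uniq ns -> all (leq 1) ns ->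
  (forall j, 0 <= w j) -> (forall j, w j ^ 2 <= gw m j) ->
  \sum_(0 <= j < size ns) (Rabs (al (nth 0%nat ns j)) * w j) <= C * (M + 1).
Proof.
move=> m0; have [C C0 HC] := mixed_norm_bound m.
have m0' : 0 < INR m by exact: INR_gt0.
(* Variables range over |z| <= 2 in [mixed_norm_bound], and 2 m (2 h) = 1 makes h z admissible for
   the kernel. The scaling is undone by D, as monomials have at most m variables. *)
pose h := / (4 * INR m).
have m1 : 1 <= INR m by apply: (le_INR 1); apply/leP.
have h0 : 0 < h by apply: Rinv_0_lt_compat; lra.
have h4 : 4 * INR m * h = 1 by rewrite /h Rinv_r; lra.
have h1 : h <= 1 by nra.
pose D := (4 * INR m) ^ m.
have D0 : 0 <= D by apply: pow_le; lra.
exists (D * ((1 + INR m) / 2 * C)).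
  by apply: Rmult_le_pos => //; apply: Rmult_le_pos => //; lra.
move=> al M Hcos Hsin Hdeg ns w uns ns0 w0 wg.
pose ps := undup (flatten [seq primes n | n <- ns]).
have pps : all prime ps.
  apply/allP => p; rewrite mem_undup => /flattenP[s /mapP[n _ ->]].
  by rewrite mem_primes => /andP[].
have ups : uniq ps by apply: undup_uniq.
pose r := undup (words m ps).
have rP n : n \in r -> exists2 s, size s = m & [/\ all prime s, n = prodn s & {subset s <= ps}].
  by rewrite mem_undup; apply: words_degree.
pose S n := [seq (p, logn p n) | p <- primes n].
have memS p j n : ((p, j) \in S n) = (p \in primes n) && (j == logn p n).
  apply/mapP/andP => [[q qn [-> ->]]|[pn /eqP ->]]; first by rewrite qn.
  by exists p.
have sizeS n : n \in r -> (size (S n) <= m)%nat.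
  by move=> /rP[s <- [prs -> _]]; rewrite size_map size_primes_prodn.
pose be n := al n * h ^ size (S n).
pose l := [seq (p, j) | p <- ps, j <- iota 1 m].
have logm n p : n \in r -> (logn p n <= m)%nat.
  by move=> /rP[s <- [prs -> _]]; rewrite logn_prodn // count_size.
have r0 n : n \in r -> (0 < n)%nat by move=> /rP[s _ [prs -> _]]; apply: prodn_gt0.
have mixed : \sum_(v <- l) sqrt (\sum_(n <- r | v \in S n) be n ^ 2) <= C * (M + 1).
  apply: HC.
  - by apply: allpairs_uniq; rewrite ?iota_uniq // => -[? ?] [? ?].
  - exact: undup_uniq.
  - by move=> n _; rewrite map_inj_uniq ?primes_uniq // => p q [].
  - move=> n nr [p j]; rewrite memS => /andP[pn /eqP ->].
    apply/allpairsP; exists (p, logn p n) => /=; split=> //.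
      by have [s _ [prs nE sub]] := rP n nr; apply: sub; rewrite -primes_prodn // -nE.
    by rewrite mem_iota add1n ltnS logm // logn_gt0 pn.
  - exact: sizeS.
  (* Unique factorization: a prime with different exponents in n and n' yields a separating variable
     (p, j), taken from whichever exponent is positive. *)
  - move=> n n' nr n'r nn'.
    have [p pp] : exists p, logn p n != logn p n'.
      case: (boolP (all (fun p => logn p n == logn p n') (primes n ++ primes n'))).
        move=> /allP eqv; case/negP: nn'; apply/eqP.
        apply: eqn_from_log (r0 n nr) (r0 n' n'r) _ => p; apply/eqP.
        case: (boolP (p \in primes n ++ primes n')) => [/eqv //|].
        by rewrite mem_cat -!logn_gt0 !lt0n negb_or !negbK => /andP[/eqP -> /eqP ->].
      by case/allPn => p _ ne; exists p.
    have nS x y : logn p x != logn p y -> (0 < logn p x)%nat ->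
        ((p, logn p x) \in S x) != ((p, logn p x) \in S y).
      by move=> xy x0; rewrite !memS -!logn_gt0 x0 eqxx (negbTE xy) andbF.
    case: (posnP (logn p n)) => [e0|]; last by move=> x0; exists (p, logn p n); apply: nS.
    exists (p, logn p n'); rewrite eq_sym; apply: nS; first by rewrite eq_sym.
    by rewrite lt0n; apply: contraNneq pp => ->; rewrite e0.
  - move=> z z2; pose zz p j := h * z (p, j).
    have -> : mpoly r be S z = \sum_(n <- r) (al n * \prod_(p <- primes n) zz p (logn p n)).
      apply: eq_bigr => n _; rewrite /be /mon big_map size_map Rmult_assoc; congr (_ * _).
      elim: (primes n) => [|p s IH]; first by rewrite !big_nil /=; ring.
      by rewrite !big_cons -IH /zz /=; ring.
    apply: (monomial_sum_bound Hcos Hsin Hdeg) => // p j.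
    rewrite /zz Rabs_mult (Rabs_pos_eq h); last by lra.
    have -> : 2 * INR m * (h * Rabs (z (p, j))) = 4 * INR m * h * (Rabs (z (p, j)) / 2) by field.
    by have := z2 (p, j); rewrite h4; lra.
(* The variables (p, 1), ..., (p, m) split the multiples of p by exponent; subadditivity of the
   square root merges them. *)
have Yle : \sum_(p <- ps) sqrt (\sum_(n <- r | p \in primes n) be n ^ 2) <= C * (M + 1).
  apply: Rle_trans mixed; rewrite /l big_allpairs_dep /=; apply: rsum_le => p pps' _.
  apply: Rle_trans (sqrt_rsum_le _ _); last first.
    by move=> j; apply: rsum_ge0 => n _ _; apply: pow2_ge_0.
  apply: sqrt_le_1_alt; apply: Req_le.
  rewrite (exchange_big_dep (fun n => p \in primes n)) /=; last first.
    by move=> j n _; rewrite memS => /andP[].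
  rewrite big_seq_cond [RHS]big_seq_cond; apply: eq_bigr => n /andP[nr pn].
  rewrite -big_filter (perm_big [:: logn p n]) ?big_seq1 //.
  apply: uniq_perm => //; first by rewrite filter_uniq // iota_uniq.
  move=> j; rewrite mem_filter memS pn inE /=; case: eqVneq => //= ->.
  by rewrite mem_iota add1n ltnS logm // logn_gt0 pn.
have rdec n : n \in r -> {subset primes n <= ps} /\ exists2 s, size s = m &
    n = prodn s /\ {subset s <= primes n}.
  move=> /rP[s sz [prs nE sub]]; split; first by move=> p; rewrite nE primes_prodn // => /sub.
  by exists s => //; split=> // p ps'; rewrite nE primes_prodn.
have lor := lorentz_from_mixed m0 (w := w) be (undup_uniq _) uns rdec wg.
apply: (Rle_trans _ (D * ((1 + INR m) / 2 * \sum_(p <- ps) sqrt (\sum_(n <- r | p \in primes n) be n ^ 2)))); last first.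
  by rewrite !Rmult_assoc; do 3! (apply: Rmult_le_compat_l; first lra).
apply: (Rle_trans _ (D * \sum_(0 <= j < size ns | nth 0%nat ns j \in r) (Rabs (be (nth 0%nat ns j)) * w j))); last exact: Rmult_le_compat_l.
rewrite -rsumZ [X in _ <= X]big_mkcond /=; apply: rsum_le => j; rewrite mem_index_iota => /andP[_ jn] _.
set n := nth _ _ _.
have nns : n \in ns by apply: mem_nth.
case: (boolP (n \in r)) => nr; last first.
  case: (Req_dec (al n) 0) => [->|/Hdeg]; first by rewrite Rabs_R0; lra.
  move=> /(_ (allP ns0 _ nns))[s sz [prs nE]]; case/negP: nr.
  rewrite mem_undup nE -sz; apply: mem_words => p pt.
  rewrite mem_undup; apply/flattenP; exists (primes n); first by apply: map_f.
  by rewrite nE primes_prodn.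
rewrite -Rmult_assoc; apply: Rmult_le_compat_r => //.
rewrite /be Rabs_mult (Rabs_pos_eq (h ^ _)); last by apply: pow_le; lra.
have Dh : 1 <= D * h ^ size (S n).
  have <- : (4 * INR m * h) ^ m = 1 by rewrite h4 pow1.
  rewrite Rpow_mult_distr; apply: Rmult_le_compat_l => //.
  rewrite -{1}(subnKC (sizeS n nr)) Rdef_pow_add -[X in _ <= X]Rmult_1_r.
  apply: Rmult_le_compat_l; first by apply: pow_le; lra.
  by rewrite -(pow1 (m - size (S n))); apply: pow_incr; lra.
by have := Rabs_pos (al n); nra.
Qed.

(** * The Lorentz space *)

Lemma has_degree_eq m n : has_degree n m -> degree_eq m n.
Proof.
have primeZ p : Znumtheory.prime (Z.of_nat p) -> prime p.
  move=> /prime_alt[p1 pP]; apply/primeP; split; first by apply/ltP; lia.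
  move=> d dp; case: (eqVneq d 1%nat) => //= d1; case: eqVneq => //= ne.
  have p0 : (0 < p)%nat by apply/ltP; lia.
  have d0 := dvdn_gt0 p0 dp; have dle := dvdn_leq p0 dp.
  case: (pP (Z.of_nat d)).
    move/ltP: d0 => d0; move/leP: dle => dle; move/eqP: d1 => d1; move/eqP: ne => ne; lia.
  by case/dvdnP: dp => q ->; exists (Z.of_nat q); rewrite -Nat2Z.inj_mul.
move=> [l [sz [pl <-]]]; exists l => //; split.
  by elim: pl => //= p s /primeZ -> _.
rewrite /prodn; elim: (l) => [|p s IH]; first by rewrite big_nil.
by rewrite big_cons -IH.
Qed.

(** * Real and imaginary parts of the complex series *)

Section ReIm.
Variables (a : nat -> C) (M : R).
Hypotheses (Hconv : forall s : C, 0 < Re s -> exists l, dirichlet_sum a s l)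
  (Hbound : forall (s l : C), 0 < Re s -> dirichlet_sum a s l -> Cmod l <= M).

Lemma im_le_Cmod z : Rabs (Im z) <= Cmod z.
Proof.
rewrite -sqrt_Rsqr_abs; apply: sqrt_le_1_alt; rewrite /Rsqr /Im /=.
by have := Rle_0_sqr (fst z); rewrite /Rsqr; lra.
Qed.

Lemma sum_n_rsum (u : nat -> R) n : sum_n u n = \sum_(0 <= k < n.+1) u k.
Proof.
by elim: n => [|n IH]; rewrite ?sum_O ?big_nat1 // sum_Sn big_nat_recr // IH.
Qed.

Lemma sum_n_pair (f : nat -> C) n :
  sum_n f n = (\sum_(0 <= k < n.+1) Re (f k), \sum_(0 <= k < n.+1) Im (f k)).
Proof.
elim: n => [|n IH]; first by rewrite sum_O !big_nat1; case: (f 0%nat).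
by rewrite sum_Sn IH !(big_nat_recr n.+1) //=; case: (f n.+1).
Qed.

Lemma dirichlet_lim x t : 0 < x -> exists l : R * R,
  [/\ Rabs l.1 <= M, Rabs l.2 <= M,
   is_lim_seq (fun N => dpart (fun n => Re (a n)) cos N x t + dpart (fun n => Im (a n)) sin N x t) (Rbar.Finite l.1) &
   is_lim_seq (fun N => dpart (fun n => Im (a n)) cos N x t - dpart (fun n => Re (a n)) sin N x t) (Rbar.Finite l.2)].
Proof.
move=> x0; have s0 : 0 < Re ((x, t) : C) by [].
have [l Hl] := Hconv s0; have lM := Hbound s0 Hl.
exists l; split.
- exact: Rle_trans (re_le_Cmod l) lM.
- exact: Rle_trans (im_le_Cmod l) lM.
(* The n-th partial sum contains the coefficients 1, ..., n + 1, which is [dpart] at N = n + 2: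
   hence two shifts. *)
- apply/is_lim_seq_incr_1/is_lim_seq_incr_1.
  apply: (is_lim_seq_ext (fun n => fst (sum_n (fun k => Cmult (a k.+1) (npow_neg k.+1 (x, t))) n))).
    move=> n; rewrite sum_n_pair /dpart !big_add1 -big_split /=; apply: eq_bigr => k _.
    by rewrite /npow_neg /Re /Im /=; ring.
  apply: (filterlim_comp _ _ _ (sum_n _) fst _ (locally l)); first exact: Hl.
  by move=> P [e HP]; exists e => y Hy; apply: HP; exact: (proj1 Hy).
- apply/is_lim_seq_incr_1/is_lim_seq_incr_1.
  apply: (is_lim_seq_ext (fun n => snd (sum_n (fun k => Cmult (a k.+1) (npow_neg k.+1 (x, t))) n))).
    move=> n; rewrite sum_n_pair /dpart !big_add1 -rsumB /=; apply: eq_bigr => k _.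
    by rewrite /npow_neg /Re /Im /=; ring.
  apply: (filterlim_comp _ _ _ (sum_n _) snd _ (locally l)); first exact: Hl.
  by move=> P [e HP]; exists e => y Hy; apply: HP; exact: (proj2 Hy).
Qed.

Lemma dpart_cosN al N x t : dpart al cos N x (- t) = dpart al cos N x t.
Proof. by apply: eq_bigr => n _; rewrite -Ropp_mult_distr_l cos_neg. Qed.

Lemma dpart_sinN al N x t : dpart al sin N x (- t) = - dpart al sin N x t.
Proof.
rewrite -[RHS]Rmult_1_l Ropp_mult_distr_r_reverse Ropp_mult_distr_l -rsumZ.
by apply: eq_bigr => n _; rewrite -Ropp_mult_distr_l sin_neg; ring.
Qed.

(* Averaging over s and its conjugate separates the four real series. *)
Lemma average_lim (u v w : nat -> R) x y : is_lim_seq u (Rbar.Finite x) -> is_lim_seq v (Rbar.Finite y) ->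
  Rabs x <= M -> Rabs y <= M -> (forall n, w n = (u n + v n) / 2) ->
  exists2 l, is_lim_seq w (Rbar.Finite l) & Rabs l <= M.
Proof.
move=> ux vy xM yM wE; exists (/ 2 * (x + y)).
  apply: (is_lim_seq_ext (fun n => / 2 * (u n + v n))); first by move=> n; rewrite wE /Rdiv Rmult_comm.
  by apply: (is_lim_seq_scal_l _ (/ 2) (Rbar.Finite (x + y))); apply: is_lim_seq_plus'.
rewrite Rabs_mult (Rabs_pos_eq (/ 2)); last by lra.
by have := Rabs_triang x y; lra.
Qed.

Lemma is_lim_seqN (u : nat -> R) x : is_lim_seq u (Rbar.Finite x) -> is_lim_seq (fun n => - u n) (Rbar.Finite (- x)).
Proof. by move/is_lim_seq_opp. Qed.

Lemma bounded_lim_Re_Im :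
  [/\ bounded_lim (fun n => Re (a n)) M cos, bounded_lim (fun n => Re (a n)) M sin,
      bounded_lim (fun n => Im (a n)) M cos & bounded_lim (fun n => Im (a n)) M sin].
Proof.
split=> x t x0; have [l [l1 l2 L1 L2]] := dirichlet_lim t x0;
  have [k [k1 k2 K1 K2]] := dirichlet_lim (- t) x0.
- by apply: (average_lim L1 K1) => // n; rewrite dpart_cosN dpart_sinN; field.
- apply: (average_lim (is_lim_seqN L2) K2); rewrite ?Rabs_Ropp // => n.
  by rewrite dpart_cosN dpart_sinN; field.
- by apply: (average_lim L2 K2) => // n; rewrite dpart_cosN dpart_sinN; field.
- apply: (average_lim L1 (is_lim_seqN K1)); rewrite ?Rabs_Ropp // => n.
  by rewrite dpart_cosN dpart_sinN; field.
Qed.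

End ReIm.

(** * Size of the Lorentz weights *)

Section Weights.
Variable m : nat.
Hypothesis m0 : (0 < m)%nat.
Let p := 2 * INR m / (INR m + 1).

(** With th = 1/p <= 1 and q = (x-1)/x one has q <= q^th, so x^th - (x-1)^th = x^th (1 - q^th) <=
    x^th (1 - q) = x^(th-1), and 2 (th - 1) = -(m-1)/m. *)
Lemma weight_bounds j : 0 <= lorentz_weight p j.+1 /\ lorentz_weight p j.+1 ^ 2 <= gw m j.
Proof.
have mp : 0 < INR m by exact: INRm0.
have m1 : 1 <= INR m by apply: (le_INR 1); apply/leP.
pose th := / p.
have thE : th = (INR m + 1) / (2 * INR m) by rewrite /th /p; field; lra.
have th0 : 0 < th by rewrite thE; apply: Rdiv_lt_0_compat; lra.
have th1 : th <= 1.
  rewrite thE; apply: (Rmult_le_reg_r (2 * INR m)); first by lra.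
  by rewrite /Rdiv Rmult_assoc Rinv_l; lra.
have x0 : 0 < INR j.+1 by apply: lt_0_INR; apply/ltP.
have gE : gw m j = Rpower (INR j.+1) (th - 1) ^ 2.
  rewrite /gw /rt -!Rpower_pow; try exact: exp_pos.
  rewrite !Rpower_mult -Rpower_Ropp; congr (Rpower _ _).
  rewrite thE -(prednK m0) S_INR -pred_Sn /=.
  by have := pos_INR m.-1; move: (INR m.-1) => q q0; field; lra.
suff h : 0 <= lorentz_weight p j.+1 <= Rpower (INR j.+1) (th - 1).
  by split; [lra|rewrite gE; apply: pow_incr].
rewrite /lorentz_weight -/th; case: j x0 {gE} => [|j] x0.
  by rewrite /Rpower /= ln_1 !Rmult_0_r exp_0; lra.
have -> : INR (Nat.sub j.+2 1) = INR j.+1 by [].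
have y0 : 0 < INR j.+1 by apply: lt_0_INR; apply/ltP.
have xy : INR j.+2 = INR j.+1 + 1 by rewrite S_INR.
move: (INR j.+2) (INR j.+1) x0 y0 xy => x y x0 y0 xy.
have yle : Rpower y th <= Rpower x th by apply: Rle_Rpower_l; lra.
split; first by lra.
have q0 : 0 < y / x by apply: Rdiv_lt_0_compat.
have q1 : y / x <= 1.
  apply: (Rmult_le_reg_r x) => //; rewrite /Rdiv Rmult_assoc Rinv_l; lra.
have -> : Rpower y th = Rpower x th * Rpower (y / x) th.
  by rewrite Rpower_mult_distr //; congr Rpower; field; lra.
have -> : Rpower x (th - 1) = Rpower x th * (1 - y / x).
  have -> : 1 - y / x = / x by rewrite xy; field; lra.
  by rewrite /Rminus Rpower_plus Rpower_Ropp Rpower_1.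
have : y / x <= Rpower (y / x) th.
  rewrite -{1}(exp_ln (y / x)) // /Rpower.
  have : ln (y / x) <= th * ln (y / x).
    by have : ln (y / x) <= ln 1 by [apply: ln_le]; rewrite ln_1; nra.
  by case/Rle_lt_or_eq_dec => [/exp_increasing|<-]; lra.
have := exp_pos (th * ln x); rewrite -/(Rpower x th); nra.
Qed.

End Weights.

(** * Non-increasing rearrangements tested on finite lists of indices *)

Section Rearrangement.
Variables (x : nat -> R) (B : R).
Hypotheses (x0 : forall n, 0 <= x n) (xB : forall n, (0 < n)%nat -> x n <= B).

Let tail (F : seq nat) (z : Rbar) : Prop :=
  exists n : nat, (0 < n)%coq_nat /\ ~ List.In n F /\ z = Rbar.Finite (Rabs (x n)).

Lemma not_InE n (F : seq nat) : ~ List.In n F <-> n \notin F.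
Proof.
split; last first.
  elim: F => [_ []|k F IH]; rewrite inE negb_or => /andP[/eqP nk /IH nF] [kn|in_F]; last exact: nF in_F.
  by apply: nk; rewrite kn.
elim: F => //= k F IH h; rewrite inE negb_or; apply/andP; split.
  by apply/eqP => nk; apply: h; left.
by apply: IH => h'; apply: h; right.
Qed.

(** The infimum is finite: every tail is nonempty, which gives the lower bound 0, and the empty
    exceptional set gives the upper bound B. *)
Lemma rearrangement_real k : (0 < k)%nat ->
  exists2 y, rearrangement x k = Rbar.Finite y & 0 <= y /\
    forall F : seq nat, (size F < k)%nat -> Rbar_le (Rbar.Finite y) (Rbar_lub (tail F)).
Proof.
move=> k0; rewrite /rearrangement /Rbar_glb; case: (Rbar_ex_glb _) => l [lb gr] /=.
have le0 : Rbar_le (Rbar.Finite 0) l.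
  apply: gr => z [F [_ ->]]; rewrite /Rbar_lub; case: (Rbar_ex_lub _) => u Hu; have [ub _] := Hu.
  change (Rbar_le (Rbar.Finite 0) u).
  (* A positive index larger than every element of F. *)
  pose n := (\sum_(i <- F) i).+1%nat.
  have nF : n \notin F.
    by apply/negP => nF; move: (leqnn n); rewrite {1}/n (big_rem n nF) /= ltnNge leq_addr.
  apply: (Rbar_le_trans _ (Rbar.Finite (Rabs (x n)))); first exact: Rabs_pos.
  apply: ub.
  by exists n; split; [apply/ltP|split=> //; apply/not_InE].
have leB : Rbar_le l (Rbar.Finite B).
  apply: (Rbar_le_trans _ (Rbar_lub (tail [::]))).
    by apply: lb; exists [::]; split => //; apply/ltP.
  rewrite /Rbar_lub; case: (Rbar_ex_lub _) => u Hu; have [_ lu] := Hu; apply: lu => z [n [n0 [_ ->]]] /=.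
  by rewrite Rabs_pos_eq //; apply: xB; apply/ltP.
case: l lb gr le0 leB => // y lb gr le0 _; exists y => //; split=> // F Fk.
by apply: lb; exists F; split => //; apply/ltP.
Qed.

(** Greedy choice: the K indices already chosen form an admissible exceptional set for k = K + 1, so
    the supremum outside them is at least y (K + 1). The slack [e] is there because a supremum need
    not be attained. *)
Lemma rearrangement_pick (y : nat -> R) K e : 0 < e ->
  (forall k, (0 < k)%nat -> rearrangement x k = Rbar.Finite (y k)) ->
  exists2 ns : seq nat, size ns = K & [/\ uniq ns, all (leq 1) ns &
    forall j, (j < K)%nat -> y j.+1 - e <= x (nth 0%nat ns j)].
Proof.
move=> e0 hy; elim: K => [|K [ns sz [uns ns0 nsP]]]; first by exists [::].
have [y' y'E [_ hK]] := rearrangement_real (ltn0Sn K).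
have yy : y' = y K.+1 by have := hy K.+1 isT; rewrite y'E => -[].
have := hK ns; rewrite sz ltnSn => /(_ isT).
case: (classic (exists2 n, (0 < n)%nat & n \notin ns /\ y K.+1 - e <= x n)) => [[n n0 [nns nP]] _|no].
  exists (rcons ns n); first by rewrite size_rcons sz.
  split=> [||j jK]; first by rewrite rcons_uniq nns.
    by rewrite all_rcons n0.
  rewrite nth_rcons sz; case: (ltngtP j K) jK => [jK _|Kj|-> _] //; first exact: nsP.
  by rewrite ltnS leqNgt Kj.
rewrite /Rbar_lub; case: (Rbar_ex_lub _) => u Hu yu; have [_ lu] := Hu; exfalso.
change (Rbar_le (Rbar.Finite y') u) in yu.
have := lu (Rbar.Finite (y' - e)); have ub : Rbar_is_upper_bound (tail ns) (Rbar.Finite (y' - e)).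
  move=> z [n [n0 [/not_InE nns ->]]] /=; rewrite Rabs_pos_eq // yy.
  case: (Rle_lt_dec (x n) (y K.+1 - e)) => // lt; case: no; exists n; first exact/ltP.
  by split=> //; lra.
move=> /(_ ub) uy; have /= := Rbar_le_trans _ _ _ yu uy; lra.
Qed.

(** Near-maximal indices transfer the bound D to the partial sums of the rearranged series, up to
    the slack times the sum of finitely many weights. As the slack tends to 0, nonnegative terms
    with bounded partial sums remain. *)
Lemma in_lorentz_of_sum_bound p D :
  (forall j, 0 <= lorentz_weight p j.+1) ->
  (forall ns : seq nat, uniq ns -> all (leq 1) ns ->
    \sum_(0 <= j < size ns) (x (nth 0%nat ns j) * lorentz_weight p j.+1) <= D) ->
  in_lorentz_p1 p x.
Proof.
move=> w0 hD; pose y k := real (rearrangement x k).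
have yE k : (0 < k)%nat -> rearrangement x k = Rbar.Finite (y k) /\ 0 <= y k.
  by move=> k0; have [z zE [z0 _]] := rearrangement_real k0; rewrite /y zE.
exists y; split; first by move=> k /leP k1; case: (yE k k1).
have part K : \sum_(0 <= j < K) (y j.+1 * lorentz_weight p j.+1) <= D.
  pose Sw := \sum_(0 <= j < K) lorentz_weight p j.+1.
  have Sw0 : 0 <= Sw by apply: rsum_ge0.
  apply: le_epsilon => e e0.
  have [d d0 dS] : exists2 d, 0 < d & d * Sw <= e.
    exists (e / (Sw + 1)); first by apply: Rdiv_lt_0_compat; lra.
    have -> : e / (Sw + 1) * Sw = e - e / (Sw + 1) by field; lra.
    have : 0 < e / (Sw + 1) by apply: Rdiv_lt_0_compat; lra.
    by lra.
  have [ns sz [uns ns0 nsP]] := rearrangement_pick K d0 (fun k k0 => proj1 (yE k k0)).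
  apply: (Rle_trans _ (\sum_(0 <= j < K) (x (nth 0%nat ns j) * lorentz_weight p j.+1) + d * Sw)).
    rewrite /Sw -rsumZ -big_split /=; apply: rsum_le => j; rewrite mem_index_iota => /andP[_ jK] _.
    rewrite -Rmult_plus_distr_r; apply: Rmult_le_compat_r => //.
    by have := nsP j jK; lra.
  by apply: Rplus_le_compat => //; rewrite -sz; apply: hD.
have [||l hl] := ex_finite_lim_seq_incr (sum_n (fun j => y j.+1 * lorentz_weight p j.+1)) D.
- move=> n; rewrite sum_Sn /plus /=.
  have : 0 <= y n.+2 * lorentz_weight p n.+2 by apply: Rmult_le_pos; [case: (yE n.+2 isT)|].
  by lra.
- by move=> n; rewrite sum_n_rsum; apply: part.
by exists l.
Qed.

End Rearrangement.

Theorem lorentz_membership m (a : nat -> C) :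
  (1 <= m)%coq_nat -> in_Hm_infty m a ->
  in_lorentz_p1 (2 * INR m / (INR m + 1)) (fun n => Cmod (a n)).
Proof.
move=> /leP m0 [hom [conv [M bnd]]].
have [Rc Rs Ic Is] := bounded_lim_Re_Im conv bnd.
have [C0 C00 HC] := lorentz_sum_bound m0.
have deg (f : C -> R) : f (RtoC 0) = 0 ->
    forall n, (0 < n)%nat -> f (a n) <> 0 -> degree_eq m n.
  move=> f0 n n0 fn; apply/has_degree_eq/hom; first exact/ltP.
  by move=> an; apply: fn; rewrite an.
set p := 2 * INR m / (INR m + 1).
have [wpos wsq] : (forall j, 0 <= lorentz_weight p j.+1) /\
    (forall j, lorentz_weight p j.+1 ^ 2 <= gw m j).
  by split=> j; have [] := weight_bounds m0 j.
have sumb (ns : seq nat) : uniq ns -> all (leq 1) ns ->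
    \sum_(0 <= j < size ns) (Cmod (a (nth 0%nat ns j)) * lorentz_weight p j.+1) <= 2 * (C0 * (M + 1)).
  move=> uns ns0.
  have := HC _ M Rc Rs (deg Re erefl) ns _ uns ns0 wpos wsq.
  have := HC _ M Ic Is (deg Im erefl) ns _ uns ns0 wpos wsq.
  move=> h1 h2; apply: (Rle_trans _ (\sum_(0 <= j < size ns) (Rabs (Re (a (nth 0%nat ns j))) * lorentz_weight p j.+1) +
     \sum_(0 <= j < size ns) (Rabs (Im (a (nth 0%nat ns j))) * lorentz_weight p j.+1))); last by lra.
  rewrite -big_split /=; apply: rsum_le => j _ _.
  rewrite -Rmult_plus_distr_r; apply: Rmult_le_compat_r => //.
  set z := a _; have {1}-> : z = Cplus (RtoC (Re z)) (Cmult Ci (RtoC (Im z))).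
    by rewrite /Cplus /Cmult /= /Re /Im; case: (z) => u v /=; congr pair; ring.
  apply: Rle_trans (Cmod_triangle _ _) _.
  by rewrite Cmod_mult !Cmod_R Cmod_Ci; lra.
apply: (@in_lorentz_of_sum_bound _ (2 * (C0 * (M + 1))) _ _ p (2 * (C0 * (M + 1)))) => //.
- by move=> n; apply: Cmod_ge_0.
(* The weight at 1 is 1, so a list with a single index bounds each coefficient. *)
move=> n n0; have := sumb [:: n] isT; rewrite /= n0 => /(_ isT).
rewrite big_nat1 /= /lorentz_weight /Rpower /= ln_1 Rmult_0_r exp_0; lra.
Qed.

End LorentzBH.

Theorem theorem5p7 (m : nat) (a : nat -> C) :
  (1 <= m)%nat -> in_Hm_infty m a ->
  in_lorentz_p1 (2 * INR m / (INR m + 1)) (fun n => Cmod (a n)).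
Proof. exact (@LorentzBH.lorentz_membership m a). Qed.
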